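(* Let $\mathfrak{g}$ be a simple Lie algebra over $\mathbb{C}$ with root system $\Phi$ of type $B_r$ or $C_r$, where $r\geq2$. Let $\mathcal{L}=\{e_\alpha\mid\alpha\in\Phi\}$ be a special Chevalley system for $\mathfrak{g}$, with corresponding signs $\{c_i\mid i\in I\}$, and let $\vec{\rho}$ be the function defined (see context) with respect to these signs. Then the signs $\varepsilon(\alpha,\beta)\in\{\pm1\}$ in the structure constants, defined by $[e_\alpha,e_\beta]=\varepsilon(\alpha,\beta)(q_{\alpha,\beta}+1)e_{\alpha+\beta}$, are given as follows, where $\alpha,\beta\in\Phi^+$ are such that $\alpha+\beta\in\Phi$. (a) If $\mathfrak{g}$ is of type $B_r$, then $\vec{\rho}(\alpha,\beta)\in2\mathbb{Z}$ and $\varepsilon(\alpha,\beta)=(-1)^{\vec{\rho}(\alpha,\beta)/2}$. (b) If $\mathfrak{g}$ is of type $C_r$, then $\vec{\rho}(\alpha,\beta)-\vec{\rho}(\beta,\alpha)\in\{\pm1,\pm2,\pm3\}$ and $$\varepsilon(\alpha,\beta)=\begin{cases}1&\text{if }\vec{\rho}(\alpha,\beta)>\vec{\rho}(\beta,\alpha),\\-1&\text{if }\vec{\rho}(\alpha,\beta)<\vec{\rho}(\beta,\alpha).\end{cases}$$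
   Context: Let $E$ be a finite-dimensional real vector space with positive-definite scalar product $\langle\;,\;\rangle$, and $\Phi\subseteq E$ an irreducible crystallographic (reduced) root system spanning $E$, with a fixed system of simple roots $\{\alpha_i\mid i\in I\}$, positive roots $\Phi^+$ and negative roots $\Phi^-$. Cartan matrix: $A=(a_{ij})_{i,j\in I}$, $a_{ij}=2\langle\alpha_i,\alpha_j\rangle/\langle\alpha_i,\alpha_i\rangle$. For $\alpha,\beta\in\Phi$ put $p_{\alpha,\beta}=\max\{m\geq0\mid\beta+m\alpha\in\Phi\}$ and $q_{\alpha,\beta}=\max\{m\geq0\mid\beta-m\alpha\in\Phi\}$. Let $\mathfrak{g}$ be a simple complex Lie algebra with Cartan subalgebra $\mathfrak h$, root system $\Phi$ and root spaces $\mathfrak{g}_\alpha$; the co-root $h_\alpha$ is the unique nonzero element of $[\mathfrak{g}_\alpha,\mathfrak{g}_{-\alpha}]$ with $[h_\alpha,x]=2x$ for all $x\in\mathfrak{g}_\alpha$; $h_i:=h_{\alpha_i}$. A collection $\mathcal{L}=\{e_\alpha\mid\alpha\in\Phi\}$ with $0\neq e_\alpha\in\mathfrak{g}_\alpha$ is a Chevalley system if $[e_\alpha,e_\beta]=\varepsilon(\alpha,\beta)(q_{\alpha,\beta}+1)e_{\alpha+\beta}$ with $\varepsilon(\alpha,\beta)\in\{\pm1\}$ whenever $\alpha,\beta,\alpha+\beta\in\Phi$. It is a special Chevalley system, with corresponding signs $\{c_i\mid i\in I\}$, $c_i\in\{\pm1\}$, if moreover for each $i\in I$: $[e_{\alpha_i},e_{-\alpha_i}]=h_i$;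 $[e_{\alpha_i},e_\alpha]=c_i(q_{\alpha_i,\alpha}+1)e_{\alpha+\alpha_i}$ if $\alpha\in\Phi^+$ and $\alpha+\alpha_i\in\Phi$; and $[e_{-\alpha_i},e_\alpha]=c_i(p_{\alpha_i,\alpha}+1)e_{\alpha-\alpha_i}$ if $\alpha\in\Phi^-$ and $\alpha-\alpha_i\in\Phi$. (The signs then satisfy $c_i=-c_j$ whenever $i\neq j$ and $a_{ij}\neq0$.) Definition of $\vec{\rho}$: let $\vec{\mathcal{I}}(A)$ be the set of all pairs $(i,j)\in I\times I$ with $i\neq j$, $a_{ij}\neq0$ and $c_i=-1$. For $\Phi$ of type $B_r$ or $C_r$, put $d_i=1$ if $\alpha_i$ is a short root and $d_i=2$ if $\alpha_i$ is a long root. For $\alpha=\sum_{i\in I}n_i\alpha_i$ and $\beta=\sum_{j\in I}m_j\alpha_j$ in $\mathbb{Z}\Phi$ (with $n_i,m_j\in\mathbb{Z}$), put $$\vec{\rho}(\alpha,\beta)=\sum_{(i,j)\in\vec{\mathcal{I}}(A)}d_ia_{ij}n_im_j\in\mathbb{Z}.$$ *)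

(* Defs.v *)
From HB Require Import structures.
From mathcomp Require Import all_boot all_order all_fingroup all_algebra.
From mathcomp Require Import sesquilinear archimedean finmap.
From mathcomp Require Import classical_sets reals complex.

Set Implicit Arguments.
Unset Strict Implicit.
Unset Printing Implicit Defensive.

Import Order.TTheory GRing.Theory Num.Theory.

Local Open Scope ring_scope.

HB.mixin Record Vector_isLieAlgebra (K : fieldType) L of Vector K L := {
  lie : {bilinear L -> L -> L};
  liexx : forall x : L, lie x x = 0;
  lie_jacobi : forall x y z : L,
    lie x (lie y z) + lie y (lie z x) + lie z (lie x y) = 0
}.

#[short(type="lieAlgType")]
HB.structure Definition LieAlgebra (K : fieldType) :=
  {L of Vector K L & Vector_isLieAlgebra K L}.

Section LieAlgebras.
Variables (K : fieldType) (L : lieAlgType K).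
Implicit Types (U V W H : {vspace L}).

Definition lie_prod U V : {vspace L} :=
  <<[seq lie x y | x <- vbasis U, y <- vbasis V]>>%VS.

Lemma lie_prodP U V W :
  reflect {in U & V, forall x y, lie x y \in W} (lie_prod U V <= W)%VS.
Proof.
apply: (iffP idP) => [/subvP sW x y xU yV | inW]; last first.
  apply/span_subvP => _ /allpairsP[[x y] /= [xU yV ->]].
  by apply: inW; apply: vbasis_mem.
apply: sW; rewrite (coord_vbasis xU) (coord_vbasis yV) linear_sumlz.
apply: memv_suml => i _; rewrite linear_sumr; apply: memv_suml => j _.
rewrite linearZl_LR linearZr_LR; apply/memvZ/memvZ/memv_span.
by apply: allpairs_f; apply: mem_nth; rewrite size_tuple.
Qed.

Definition lie_ideal U := (lie_prod fullv U <= U)%VS.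

Definition simple_lie : Prop :=
  (lie_prod fullv fullv != 0 :> {vspace L})%VS /\
  forall U, lie_ideal U -> U = 0%VS \/ U = fullv.

Definition lower_central H (n : nat) := iter n (lie_prod H) H.

Definition is_cartan_subalgebra H : Prop :=
  [/\ (lie_prod H H <= H)%VS,
      exists n, lower_central H n = 0%VS
    & forall x, {in H, forall y, lie x y \in H} -> x \in H].

Variable H : {vspace L}.
Implicit Types (lam : 'Hom(subvs_of H, K^o)).

(* It suffices to impose [h, x] = lam(h) x for h in a basis of H; see
   root_spaceP. *)
Definition root_space lam : {vspace L} :=
  (\bigcap_(i < \dim {:subvs_of H})
     passmx.leigenspace (linfun (lie (vsval (vbasis {:subvs_of H})`_i)))
                 (lam (vbasis {:subvs_of H})`_i))%VS.

Lemma root_spaceP lam x :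
  reflect (forall h : subvs_of H, lie (vsval h) x = lam h *: x)
          (x \in root_space lam).
Proof.
have lieE (h : subvs_of H) (a : K) :
    (x \in passmx.leigenspace (linfun (lie (vsval h))) a) =
    (lie (vsval h) x == a *: x).
  rewrite memv_ker add_lfunE opp_lfunE scale_lfunE id_lfunE lfunE.
  exact: subr_eq0.
apply: (iffP idP) => [xlam h | hx]; last first.
  rewrite [_ \in _]memvE; apply/subv_bigcapP => i _.
  by rewrite -memvE lieE hx.
have xi i : lie (vsval (vbasis {:subvs_of H})`_i) x
    = lam (vbasis {:subvs_of H})`_i *: x.
  have [lti | gei] := ltnP i (\dim {:subvs_of H}); last first.
    by rewrite nth_default ?size_tuple // !linear0 linear0l scale0r.
  apply/eqP; rewrite -lieE; apply: subvP xlam.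
  exact: (bigcapv_inf (Ordinal lti) isT (subvv _)).
rewrite (coord_vbasis (memvf h)) !linear_sum linear_sumlz scaler_suml.
apply: eq_bigr => i _.
by rewrite !linearZ linearZl_LR xi /= scalerA.
Qed.

Definition is_lie_root lam : bool := (lam != 0) && (root_space lam != 0%VS).

Definition is_coroot lam (h : L) : Prop :=
  [/\ h \in lie_prod (root_space lam) (root_space (- lam)), h != 0
    & {in root_space lam, forall x, lie h x = 2 *: x}].

End LieAlgebras.

Section RootSystems.
Variables (R : realType) (E : vectType R) (dot : {dot E for idfun}).
Variable (Phi : {fset E}).

Definition cartan_number (a b : E) : R := 2 * dot a b / dot a a.

Definition is_root_system : Prop :=
  [/\ <<enum_fset Phi>>%VS = fullv, 0 \notin Phi,
      {in Phi &, forall a b, b - cartan_number a b *: a \in Phi},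
      {in Phi &, forall a b, cartan_number a b \is a Num.int}
    & {in Phi, forall a (t : R), t *: a \in Phi -> t = 1 \/ t = -1}].

Definition is_irreducible : Prop :=
  Phi != fset0 /\
  forall Psi : {fset E}, (Psi `<=` Phi)%fset ->
    {in Psi & (Phi `\` Psi)%fset, forall a b, dot a b = 0} ->
    Psi = fset0 \/ Psi = Phi.

(* string_up a b and string_down a b are the usual p_{a,b} and q_{a,b}. Both
   maxima exist when Phi is finite, a != 0 and b \in Phi; the default 0 of xget
   is then irrelevant. *)
Definition string_up (a b : E) : nat :=
  xget 0%N [set m : nat | b + a *+ m \in Phi /\
                          forall k, b + a *+ k \in Phi -> (k <= m)%N].
Definition string_down (a b : E) : nat :=
  xget 0%N [set m : nat | b - a *+ m \in Phi /\
                          forall k, b - a *+ k \in Phi -> (k <= m)%N].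

Variables (r : nat) (Delta : r.-tuple E).

Definition is_simple_system : Prop :=
  [/\ {subset Delta <= Phi}, basis_of fullv Delta
    & {in Phi, forall b, exists n : 'I_r -> nat,
        let c := \sum_i tnth Delta i *+ n i in b = c \/ b = - c}].

Definition is_pos_root (b : E) : bool :=
  (b \in Phi) && [forall i, 0 <= coord Delta i b].
Definition is_neg_root (b : E) : bool :=
  (b \in Phi) && [forall i, coord Delta i b <= 0].

(* The coordinates of an element of the root lattice and the entries of the
   Cartan matrix are integers, so Num.floor merely casts them to int. *)
Definition root_coef (b : E) (i : 'I_r) : int := Num.floor (coord Delta i b).
Definition cartan_matrix : 'M[int]_r :=
  \matrix_(i, j) Num.floor (cartan_number (tnth Delta i) (tnth Delta j)).

Definition is_short_root (a : E) : bool :=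
  all (fun b => dot a a <= dot b b) (enum_fset Phi).

Definition root_weight (i : 'I_r) : int :=
  if is_short_root (tnth Delta i) then 1 else 2.

Definition rho_vec (c : 'I_r -> int) (a b : E) : int :=
  \sum_i \sum_(j | [&& i != j, cartan_matrix i j != 0 & c i == -1])
    root_weight i * cartan_matrix i j * root_coef a i * root_coef b j.

End RootSystems.

(* The nodes 0, ..., r.-1 form a chain, the last edge being double. As
   a_ij = 2 <a_i, a_j> / <a_i, a_i>, the entry -2 is in the row of the shorter
   root: the last simple root is the short one in type B_r and the long one in
   type C_r. *)
Definition cartan_B (r : nat) : 'M[int]_r :=
  \matrix_(i, j)
    if i == j :> nat then 2
    else if i.+1 == j :> nat then -1
    else if j.+1 == i :> nat then (if i.+1 == r then -2 else -1)
    else 0.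
Definition cartan_C (r : nat) : 'M[int]_r := (cartan_B r)^T.

Definition same_type (r : nat) (A A' : 'M[int]_r) : Prop :=
  exists s : 'S_r, forall i j, A (s i) (s j) = A' i j.

Section ChevalleySystems.
Variables (R : realType) (L : lieAlgType R[i]) (H : {vspace L}).
Variables (E : vectType R) (Phi : {fset E}).
Variable iota : E -> 'Hom(subvs_of H, R[i]^o).

(* Phi, as a subset of E, is the root system of L with respect to H: iota
   identifies E with a real subspace of the dual of H, and Phi with the set of
   roots. *)
Definition is_root_identification : Prop :=
  [/\ forall (t : R) (u v : E), iota (t *: u + v) = t%:C%C *: iota u + iota v,
      injective iota
    & forall lam, is_lie_root lam <-> exists2 a, a \in Phi & iota a = lam].

Variables (e : E -> L) (eps : E -> E -> int).

Definition is_chevalley_system : Prop :=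
  {in Phi, forall a, e a \in root_space (iota a) /\ e a != 0} /\
  {in Phi &, forall a b, a + b \in Phi ->
    (eps a b = 1 \/ eps a b = -1) /\
    lie (e a) (e b) = e (a + b) *~ (eps a b * (string_down Phi a b).+1%:Z)}.

Variables (r : nat) (Delta : r.-tuple E) (c : 'I_r -> int).

Definition is_special_chevalley_system : Prop :=
  is_chevalley_system /\ forall i : 'I_r, let ai := tnth Delta i in
  [/\ c i = 1 \/ c i = -1,
      is_coroot (iota ai) (lie (e ai) (e (- ai))),
      forall a, is_pos_root Phi Delta a -> a + ai \in Phi ->
        lie (e ai) (e a) = e (a + ai) *~ (c i * (string_down Phi ai a).+1%:Z)
    & forall a, is_neg_root Phi Delta a -> a - ai \in Phi ->
        lie (e (- ai)) (e a) = e (a - ai) *~ (c i * (string_up Phi ai a).+1%:Z)].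

End ChevalleySystems.

(* Main.v *)
Require Import Defs.
From mathcomp Require Import all_boot all_order all_fingroup all_algebra.
From mathcomp Require Import sesquilinear archimedean finmap.
From mathcomp Require Import reals complex.
From mathcomp Require Import zify ring lra.

Set Implicit Arguments.
Unset Strict Implicit.
Unset Printing Implicit Defensive.

Import Order.TTheory GRing.Theory Num.Theory.

Local Open Scope ring_scope.

(** Why the theorem is true.

The Jacobi identity expresses N(x,y) N(x+y,z) as the sum of
N(y,z) N(x,y+z) and - N(x,z) N(y,x+z).  In a Chevalley system the constant
N(a,b) is the sign eps(a,b) times a positive integer, and the left side is
nonzero as soon as x+y and x+y+z are roots.  Hence if the terms on the right
that do not vanish all have the same sign t, then
eps(x,y) eps(x+y,z) = t ([eps_jacobi_sign]), whatever the sizes q+1 of the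
structure constants.  Together with skew-symmetry and the prescribed values
eps(alpha_i,b) = c_i, this is what the inductions below use to verify a formula
for the signs.  The record [structure_signs] isolates these properties; after
it Lie algebras disappear, and what remains is about root systems.  Since
c_i = - c_j for adjacent nodes, exactly one orientation of each edge of the
diagram contributes to rho.

Type B.  Here rho = - 2 f with f an integral bilinear form ([pairing]), so the
candidate (-1)^f is bimultiplicative.  Therefore the first term on the right
always has the expected sign, and the second has it as soon as
f(a,b) + f(b,a) is odd whenever a, b and a+b are roots ([pairing_odd]).  That
follows from lengths alone: with short roots of squared length 1 and long ones
of squared length 2, f(a,b) + f(b,a) is congruent mod 2 to (a,b) + n m, where n
and m are the coefficients of a and b on the short simple root; the parity of n
is that of (a,a); and (a,b) is determined by the squared lengths of a, b and
a+b, each of which is 1 or 2.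

Type C.  The candidate is the sign of a bilinear form, which is not
multiplicative, so coordinates are used.  In the orthogonal basis e_0, e_1, ...
with alpha_k = e_k - e_(k+1) and last simple root 2 e_(r-1), every root has
integral coordinates with absolute values summing to 2 ([root_ell1]).  When a,
b and a+b are roots some coordinate must cancel in the sum, so up to exchanging
them a = e_j - e_(i+1) with j <= i, and b has a positive coordinate on e_(i+1).
Then eps(a,b) = c_i ([signs_ediff], by induction on i), while
c_i (rho(a,b) - rho(b,a)) is the coordinate of b on e_(i+1) plus a nonnegative
combination, with coefficients at most 2, of the coordinates before it; it lies
between 1 and 3 ([rho_skew_ediff]). *)

(** * Signs of structure constants and the Jacobi identity *)

Lemma sign_unique (s t p q : int) : s = 1 \/ s = -1 -> t = 1 \/ t = -1 ->
  0 < p -> 0 <= q -> s * p = t * q -> s = t.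
Proof. by move=> [] -> [] ->; lia. Qed.

Lemma signM (s t : int) : s = 1 \/ s = -1 -> t = 1 \/ t = -1 ->
  s * t = 1 \/ s * t = -1.
Proof. by move=> [] -> [] ->; [left | right | right | left]. Qed.

Section LieSigns.
Variables (R : realType) (L : lieAlgType R[i]) (H : {vspace L}).
Variables (E : vectType R) (Phi : {fset E}).
Variable iota : E -> 'Hom(subvs_of H, R[i]^o).
Hypothesis hiota : is_root_identification Phi iota.

Lemma lieC (x y : L) : lie x y = - lie y x.
Proof.
apply/eqP; rewrite -addr_eq0; apply/eqP.
by have := liexx (x + y); rewrite linearDl !linearDr !liexx add0r addr0.
Qed.

Lemma lie_derivation (x y z : L) :
  lie x (lie y z) = lie (lie x y) z + lie y (lie x z).
Proof.
have := lie_jacobi x y z.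
rewrite (lieC z x) linearNr (lieC z (lie x y)) -addrA -opprD => /eqP.
by rewrite subr_eq0 addrC => /eqP.
Qed.

Lemma iotaD a b : iota (a + b) = iota a + iota b.
Proof. by have [h _ _] := hiota; have := h 1 a b; rewrite !scale1r. Qed.

Lemma iota0 : iota 0 = 0.
Proof. by apply: (addrI (iota 0)); rewrite -iotaD !addr0. Qed.

Lemma lie_root_space a b x y :
  x \in root_space (iota a) -> y \in root_space (iota b) ->
  lie x y \in root_space (iota (a + b)).
Proof.
move=> /root_spaceP xa /root_spaceP yb; apply/root_spaceP => h.
rewrite lie_derivation xa yb linearZl_LR linearZr_LR -scalerDl.
by rewrite iotaD add_lfunE.
Qed.

Lemma root_space_eq0 a : a != 0 -> a \notin Phi -> root_space (iota a) = 0%VS.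
Proof.
have [_ inj hroot] := hiota.
move=> a0 aPhi; apply/eqP; apply: contraNT aPhi => ra.
have [] := (hroot (iota a)).1 => [|b bPhi /inj <- //].
by rewrite /is_lie_root ra andbT; apply: contra a0 => /eqP;
  rewrite -iota0 => /inj ->.
Qed.

Variables (e : E -> L) (eps : E -> E -> int).
Hypothesis hch : is_chevalley_system Phi iota e eps.

Lemma eps_sign a b : a \in Phi -> b \in Phi -> a + b \in Phi ->
  eps a b = 1 \/ eps a b = -1.
Proof. by move=> aP bP abP; have [_ /(_ a b aP bP abP)[]] := hch. Qed.

Definition struct_const (a b : E) : int :=
  if a + b \in Phi then eps a b * (string_down Phi a b).+1%:Z else 0.

(** If [a + b] is neither zero nor a root, then its root space vanishes, so the
bracket is zero, in agreement with the convention that extends the structure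
constants by 0. *)
Lemma lie_struct a b : a \in Phi -> b \in Phi -> a + b != 0 ->
  lie (e a) (e b) = e (a + b) *~ struct_const a b.
Proof.
move=> aP bP ab0; have [h1 h2] := hch; rewrite /struct_const.
case: ifPn => abP; first by have [] := h2 a b aP bP abP.
have [ea _] := h1 a aP; have [eb _] := h1 b bP.
have := lie_root_space ea eb; rewrite root_space_eq0 // memv0 => /eqP ->.
by rewrite mulr0z.
Qed.

Lemma eMz_inj a (m n : int) : a \in Phi -> e a *~ m = e a *~ n -> m = n.
Proof.
move=> aP; have [/(_ a aP)[_ ea0] _] := hch.
move=> /eqP; rewrite -subr_eq0 -mulrzBr -scaler_int scaler_eq0 (negPf ea0) orbF.
by rewrite intr_eq0 subr_eq0 => /eqP.
Qed.

Lemma lieMzr (x y : L) (n : int) : lie x (y *~ n) = lie x y *~ n.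
Proof. exact: raddfMz. Qed.

Lemma lieMzl (x y : L) (n : int) : lie (x *~ n) y = lie x y *~ n.
Proof. by rewrite lieC lieMzr -mulNrz -lieC. Qed.

Lemma eps_skew a b : a \in Phi -> b \in Phi -> a + b \in Phi -> a + b != 0 ->
  eps a b = - eps b a.
Proof.
move=> aP bP abP ab0; have := lie_struct aP bP ab0.
have baP : b + a \in Phi by rewrite addrC.
rewrite lieC (lie_struct bP aP) (addrC b a) // -mulrNz => /(eMz_inj abP).
rewrite /struct_const abP baP.
by case: (eps_sign aP bP abP) (eps_sign bP aP baP) => -> [] -> ; lia.
Qed.

Lemma struct_const_jacobi x y z :
  x \in Phi -> y \in Phi -> z \in Phi -> x + y + z \in Phi ->
  x + y != 0 -> y + z != 0 -> x + z != 0 -> x + y + z != 0 ->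
  x + y \in Phi ->
  struct_const x y * struct_const (x + y) z =
  struct_const y z * struct_const x (y + z) -
  struct_const x z * struct_const y (x + z).
Proof.
move=> xP yP zP xyzP xy0 yz0 xz0 xyz0 xyP.
have Exyz : y + (x + z) = x + y + z by rewrite addrCA addrA.
apply: (eMz_inj xyzP); have := lie_derivation (e x) (e y) (e z).
move=> /esym/eqP; rewrite -subr_eq0 -addrA addr_eq0 opprD opprK => /eqP.
rewrite (lie_struct xP yP) // (lie_struct yP zP) // (lie_struct xP zP) //.
rewrite lieMzl !lieMzr lie_struct // -mulrzA mulrC => ->.
rewrite mulrzBr addrC; congr (_ - _).
- have [yzP|yzP] := boolP (y + z \in Phi).
    by rewrite lie_struct ?addrA // -mulrzA mulrC.
  by rewrite /struct_const (negPf yzP) mul0r !mulr0z.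
- have [xzP|xzP] := boolP (x + z \in Phi).
    by rewrite lie_struct ?Exyz // -mulrzA mulrC.
  by rewrite /struct_const (negPf xzP) mul0r !mulr0z.
Qed.

(** Only signs matter in the Jacobi identity: both sides being sums of signed
positive integers, terms of equal sign cannot cancel. *)
Lemma eps_jacobi_sign t x y z :
  x \in Phi -> y \in Phi -> z \in Phi -> x + y \in Phi -> x + y + z \in Phi ->
  0 \notin Phi -> y + z != 0 -> x + z != 0 -> t = 1 \/ t = -1 ->
  (y + z \in Phi -> eps y z * eps x (y + z) = t) ->
  (x + z \in Phi -> - (eps x z * eps y (x + z)) = t) ->
  eps x y * eps (x + y) z = t.
Proof.
move=> xP yP zP xyP xyzP P0 yz0 xz0 t1 h1 h2.
have xy0 : x + y != 0 by apply: contraNneq P0 => <-.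
have xyz0 : x + y + z != 0 by apply: contraNneq P0 => <-.
have P1 : x + (y + z) \in Phi by rewrite addrA.
have P2 : y + (x + z) \in Phi by rewrite addrCA addrA.
have := struct_const_jacobi xP yP zP xyzP xy0 yz0 xz0 xyz0 xyP.
rewrite /struct_const xyP xyzP P1 P2 mulrACA.
have s1 : eps x y * eps (x + y) z = 1 \/ eps x y * eps (x + y) z = -1.
  exact: signM (eps_sign xP yP xyP) (eps_sign xyP zP xyzP).
move=> Esum; have [Q Q0 EQ] : exists2 Q : int, 0 <= Q &
    eps x y * eps (x + y) z *
      ((string_down Phi x y).+1%:Z * (string_down Phi (x + y) z).+1%:Z) = t * Q.
  rewrite Esum; set u := (if _ then _ else _) * _.
  set v := (if _ then _ else _) * _.
  have [Q1 Q10 ->] : exists2 Q : int, 0 <= Q & u = t * Q.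
    rewrite /u; case: ifP => [yzP|_]; last by exists 0; rewrite ?mulr0 ?mul0r.
    by rewrite mulrACA h1 //; eexists; last by []; rewrite mulr_ge0.
  have [Q2 Q20 ->] : exists2 Q : int, 0 <= Q & v = - (t * Q).
    rewrite /v; case: ifP => [xzP|_].
      by rewrite mulrACA -h2 //; eexists; last rewrite mulNr opprK //;
        rewrite mulr_ge0.
    by exists 0; rewrite ?mulr0 ?mul0r ?oppr0.
  by exists (Q1 + Q2); rewrite ?addr_ge0 // opprK mulrDr.
exact: sign_unique s1 t1 _ Q0 EQ.
Qed.

End LieSigns.

(** * Root lattice, positive roots and simple reflections *)

Section RootLattice.
Variables (R : realType) (E : vectType R) (dot : {dot E for idfun}).
Variable Phi : {fset E}.
Hypothesis hPhi : is_root_system dot Phi.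
Variables (r : nat) (Delta : r.-tuple E).
Hypothesis hDelta : is_simple_system Phi Delta.

Notation D i := (tnth Delta i).
Notation cf := (root_coef Delta).
Notation pos := (is_pos_root Phi Delta).

Lemma dotC u v : dot u v = dot v u.
Proof. by rewrite hermitian_subproof expr0 mul1r. Qed.

Lemma dotZl k u v : dot (k *: u) v = k * dot u v.
Proof. exact: linearZl_LR. Qed.

Lemma dotZr k u v : dot u (k *: v) = k * dot u v.
Proof. by rewrite dotC dotZl dotC. Qed.

Lemma dot_gt0 u : u != 0 -> 0 < dot u u.
Proof. exact: neq0_dnorm_gt0. Qed.

Lemma zero_not_root : 0 \notin Phi. Proof. by case: hPhi. Qed.

Lemma root_neq0 a : a \in Phi -> a != 0.
Proof. by apply: contraTneq => ->; exact: zero_not_root. Qed.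

Lemma root_norm_gt0 a : a \in Phi -> 0 < dot a a.
Proof. by move=> /root_neq0/dot_gt0. Qed.

Definition refl a b : E := b - cartan_number dot a b *: a.

Lemma refl_root a b : a \in Phi -> b \in Phi -> refl a b \in Phi.
Proof. by have [_ _ h _ _] := hPhi; exact: h. Qed.

Lemma cartan_self a : a \in Phi -> cartan_number dot a a = 2.
Proof.
by move=> aP; rewrite /cartan_number mulfK // gt_eqF // root_norm_gt0.
Qed.

Lemma cartanB a b c (k : R) :
  cartan_number dot a (b - k *: c) = cartan_number dot a b - k * cartan_number dot a c.
Proof.
by rewrite /cartan_number linearBr /= dotZr; ring.
Qed.

Lemma reflK a b : a \in Phi -> refl a (refl a b) = b.
Proof.
move=> aP; rewrite /refl cartanB cartan_self // -addrA -opprD -scalerDl.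
have -> k : k + (k - k * 2) = 0 :> R by ring.
by rewrite scale0r subr0.
Qed.

Lemma opp_root a : a \in Phi -> - a \in Phi.
Proof.
move=> aP; have := refl_root aP aP; rewrite /refl cartan_self //.
by rewrite scaler_nat mulr2n opprD addrA subrr add0r.
Qed.

Lemma refl_norm a b : a \in Phi -> dot (refl a b) (refl a b) = dot b b.
Proof.
move=> aP; have a0 : dot a a != 0 by rewrite gt_eqF // root_norm_gt0.
rewrite /refl linearBl !linearBr /= !(dotZl, dotZr) (dotC b a) /cartan_number.
by field.
Qed.

(** If neither of the two Cartan integers is 1, both are at least 2, so [dot a b]
is at least [dot a a] and at least [dot b b]; then [a - b] has nonpositive
norm, which forces [a = b]. *)
Lemma root_diff a b : a \in Phi -> b \in Phi -> 0 < dot a b -> a != b ->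
  b - a \in Phi.
Proof.
move=> aP bP ab0 nab.
have aa0 := root_norm_gt0 aP; have bb0 := root_norm_gt0 bP.
have [_ _ _ hint _] := hPhi.
have key u v : u \in Phi -> v \in Phi -> 0 < dot u v ->
    cartan_number dot u v = 1 \/ dot u u <= dot u v.
  move=> uP vP uv0; have uu0 := root_norm_gt0 uP.
  have : 0 < cartan_number dot u v by rewrite divr_gt0 // mulr_gt0.
  have /intrP[n cn] := hint u v uP vP; rewrite cn ltr0z => n0.
  have [/eqP ->|n1] := boolP (n == 1); [by left | right].
  have n2 : 2%:~R <= n%:~R :> R by rewrite ler_int; lia.
  rewrite -cn /cartan_number ler_pdivlMr // in n2.
  by rewrite -(ler_pM2l (ltr0Sn R 1)).
have [h|h1] := key a b aP bP ab0.
  by have := refl_root aP bP; rewrite /refl h scale1r.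
have [h|h2] := key b a bP aP (eq_ind_r (fun x => 0 < x) ab0 (dotC b a)).
  have := opp_root (refl_root bP aP).
  by rewrite /refl h scale1r opprB.
have /dot_gt0 : a - b != 0 by rewrite subr_eq0.
rewrite linearBl !linearBr /=.
by move: h1 h2; rewrite (dotC b a); lra.
Qed.

Lemma basisD : basis_of fullv Delta. Proof. by case: hDelta. Qed.

Lemma simple_root i : D i \in Phi.
Proof. by case: hDelta => h _ _; apply: h; exact: mem_tnth. Qed.

(** [root_coef] rounds coordinates down, hence is additive only under an
integrality condition; this predicate describes the root lattice. *)
Definition in_lattice b := forall i, coord Delta i b = (cf b i)%:~R.

Lemma in_latticeP b : (forall i, exists n : int, coord Delta i b = n%:~R) ->
  in_lattice b.
Proof. by move=> h i; have [n hn] := h i; rewrite /root_coef hn intrKfloor. Qed.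

Lemma coord_simple i j : coord Delta i (D j) = (i == j)%:R.
Proof.
by rewrite (tnth_nth 0) coord_free ?(basis_free basisD) // eq_sym.
Qed.

Lemma in_lattice_simple i : in_lattice (D i).
Proof. by apply: in_latticeP => j; exists ((j == i)%:R); rewrite coord_simple; case: eqP. Qed.

Lemma cf_simple i j : cf (D i) j = (j == i)%:R.
Proof. by rewrite /root_coef coord_simple; case: eqP; rewrite ?floor1 ?floor0. Qed.

Lemma in_latticeD a b : in_lattice a -> in_lattice b -> in_lattice (a + b).
Proof.
move=> ha hb; apply: in_latticeP => i; exists (cf a i + cf b i).
by rewrite linearD /= ha hb intrD.
Qed.

Lemma cfD a b i : in_lattice a -> in_lattice b -> cf (a + b) i = cf a i + cf b i.
Proof.
by move=> ha hb; rewrite {1}/root_coef linearD /= ha hb -intrD intrKfloor.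
Qed.

Lemma in_latticeZ (n : int) a : in_lattice a -> in_lattice (n%:~R *: a).
Proof.
move=> ha; apply: in_latticeP => i; exists (n * cf a i).
by rewrite linearZ /= ha intrM.
Qed.

Lemma cfZ (n : int) a i : in_lattice a -> cf (n%:~R *: a) i = n * cf a i.
Proof. by move=> ha; rewrite {1}/root_coef linearZ /= ha -intrM intrKfloor. Qed.

Lemma in_latticeN a : in_lattice a -> in_lattice (- a).
Proof. by move=> /(in_latticeZ (-1)); rewrite scaleN1r. Qed.

Lemma cfN a i : in_lattice a -> cf (- a) i = - cf a i.
Proof. by move=> ha; rewrite -scaleN1r -[-1]/((-1)%:~R) cfZ // mulN1r. Qed.

Lemma cfB a b i : in_lattice a -> in_lattice b -> cf (a - b) i = cf a i - cf b i.
Proof. by move=> ha hb; rewrite cfD ?cfN //; exact: in_latticeN. Qed.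

Lemma latticeE b : in_lattice b -> b = \sum_i (cf b i)%:~R *: D i.
Proof.
move=> hb; rewrite {1}(coord_basis basisD (memvf b)).
by apply: eq_bigr => i _; rewrite hb (tnth_nth 0).
Qed.

Lemma cf_inj a b : in_lattice a -> in_lattice b -> cf a =1 cf b -> a = b.
Proof.
by move=> ha hb hab; rewrite (latticeE ha) (latticeE hb);
  apply: eq_bigr => i _; rewrite hab.
Qed.

Lemma coord_sum_simple (n : 'I_r -> R) i :
  coord Delta i (\sum_j n j *: D j) = n i.
Proof.
rewrite linear_sum (bigD1 i) //= linearZ /= coord_simple eqxx big1 ?addr0 //=.
  by rewrite mulr1.
by move=> j ji; rewrite linearZ /= coord_simple eq_sym (negPf ji) mulr0.
Qed.

Lemma root_in_lattice b : b \in Phi -> in_lattice b.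
Proof.
have [_ _ h] := hDelta => /h[n hn]; apply: in_latticeP => i.
have E0 : coord Delta i (\sum_j D j *+ n j) = (n i)%:R.
  under eq_bigr => j _ do rewrite -scaler_nat.
  exact: coord_sum_simple.
case: hn => ->; [exists (n i)%:Z | exists (- (n i)%:Z)].
  by rewrite E0.
by rewrite linearN /= E0 intrN.
Qed.

Lemma posE b : pos b = (b \in Phi) && [forall i, 0 <= cf b i].
Proof.
rewrite /is_pos_root; case: (boolP (b \in Phi)) => //= bP.
by apply: eq_forallb => i; rewrite (root_in_lattice bP) ler0z.
Qed.

Lemma pos_root b : pos b -> b \in Phi. Proof. by case/andP. Qed.

Lemma pos_lattice b : pos b -> in_lattice b.
Proof. by move/pos_root/root_in_lattice. Qed.

Lemma pos_cf b i : pos b -> 0 <= cf b i.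
Proof. by rewrite posE => /andP[_ /forallP]. Qed.

Lemma pos_simple i : pos (D i).
Proof.
by rewrite posE simple_root; apply/forallP => j; rewrite cf_simple; case: eqP.
Qed.

Lemma root_sign b : b \in Phi -> pos b \/ pos (- b).
Proof.
move=> bP; have bL := root_in_lattice bP; have nbP := opp_root bP.
have [_ _ h] := hDelta; have [n hn] := h b bP.
have E0 i : coord Delta i (\sum_j D j *+ n j) = (n i)%:R.
  under eq_bigr => j _ do rewrite -scaler_nat.
  exact: coord_sum_simple.
case: hn => Eb; [left | right]; rewrite /is_pos_root ?bP ?nbP; apply/forallP => i.
  by rewrite Eb E0 ler0n.
by rewrite Eb opprK E0 ler0n.
Qed.

Lemma pos_of_cf b i : b \in Phi -> 0 < cf b i -> pos b.
Proof.
move=> bP bi; have [//|/(pos_cf i)] := root_sign bP.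
by rewrite (cfN _ (root_in_lattice bP)) oppr_ge0 leNgt bi.
Qed.

Lemma posD a b : pos a -> pos b -> a + b \in Phi -> pos (a + b).
Proof.
move=> pa pb abP; rewrite posE abP; apply/forallP => i.
by rewrite cfD ?addr_ge0 ?pos_cf //; exact: pos_lattice.
Qed.

Lemma pos_add_neq0 a b : pos a -> pos b -> a + b != 0.
Proof.
move=> pa pb; apply/eqP => ab0.
have aL := pos_lattice pa; have bL := pos_lattice pb.
have /negP := root_neq0 (pos_root pa); apply; apply/eqP.
apply: cf_inj => // [|i]; first by apply: in_latticeP => i; exists 0; rewrite linear0.
have E0 : cf 0 i = 0 by rewrite /root_coef linear0 floor0.
have := cfD i aL bL; rewrite ab0 E0.
by have := pos_cf i pa; have := pos_cf i pb; lia.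
Qed.

(** Otherwise [b] would be a multiple of [D i], and the root system is
reduced. *)
Lemma pos_other_coef b i : pos b -> b != D i -> exists2 j, j != i & 0 < cf b j.
Proof.
move=> pb nb; apply/exists_inP; apply: contraR nb => /exists_inPn h.
have bL := pos_lattice pb; have bP := pos_root pb.
have Eb : b = (cf b i)%:~R *: D i.
  apply: cf_inj => // [|j]; first exact/in_latticeZ/in_lattice_simple.
  rewrite cfZ; last exact: in_lattice_simple.
  rewrite cf_simple; case: eqP => [->|/eqP ji]; first by rewrite mulr1.
  by have := h j ji; have := pos_cf j pb; lia.
have [_ _ _ _ hred] := hPhi.
have hm := bP; rewrite Eb in hm.
have := pos_cf i pb; have [b1|b1] := hred _ (simple_root i) _ hm.
  by rewrite Eb b1 scale1r.
by move: b1 => /eqP; rewrite -[-1]/((-1)%:~R) eqr_int => /eqP ->.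
Qed.

(** The norm of [b] is the combination of the numbers [dot (D i) b] with the
nonnegative coefficients of [b], and it is positive. *)
Lemma pos_dot_simple b : pos b -> exists i, 0 < cf b i /\ 0 < dot (D i) b.
Proof.
move=> pb; have := root_norm_gt0 (pos_root pb).
rewrite {1}(latticeE (pos_lattice pb)) linear_sumlz.
move=> h; have [i hi] : exists i, 0 < (cf b i)%:~R * dot (D i) b.
  apply/existsP; apply: contraTT h => /existsPn h; rewrite -leNgt.
  by apply: sumr_le0 => i _ /=; rewrite dotZl leNgt; exact: h.
have i0 : 0 < cf b i.
  rewrite lt_neqAle pos_cf // andbT; apply: contraTneq hi => <-.
  by rewrite mulr0z mul0r ltxx.
by exists i; split=> //; rewrite pmulr_rgt0 ?ltr0z in hi.
Qed.

Lemma pos_sub_simple b : pos b -> (exists i, b = D i) \/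
  exists i, pos (b - D i).
Proof.
move=> pb; have [i [bi dib]] := pos_dot_simple pb.
have [->|nb] := eqVneq b (D i); first by left; exists i.
right; exists i; have [j ji bj] := pos_other_coef pb nb.
have bP : b - D i \in Phi.
  by apply: root_diff; rewrite ?simple_root ?(pos_root pb) // eq_sym.
apply: (pos_of_cf (i := j)) => //.
rewrite cfB ?cf_simple ?(negPf ji) ?subr0 //; first exact: pos_lattice.
exact: in_lattice_simple.
Qed.

Definition height b : nat := absz (\sum_i cf b i).

Lemma height_pos b : pos b -> (height b)%:Z = \sum_i cf b i.
Proof. by move=> pb; rewrite gez0_abs // sumr_ge0 // => i _; exact: pos_cf. Qed.

Lemma sum_cf_simple i : \sum_j cf (D i) j = 1.
Proof.
rewrite (bigD1 i) //= cf_simple eqxx big1 ?addr0 // => j ji.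
by rewrite cf_simple (negPf ji).
Qed.

Lemma height_sub b i (n : int) : pos b -> pos (b - n%:~R *: D i) ->
  (height (b - n%:~R *: D i))%:Z = (height b)%:Z - n.
Proof.
move=> pb pb'; rewrite !height_pos //.
under eq_bigr => j _.
  rewrite cfB; [| exact: pos_lattice | exact/in_latticeZ/in_lattice_simple].
  rewrite cfZ; last exact: in_lattice_simple.
  over.
by rewrite sumrB -mulr_sumr sum_cf_simple mulr1.
Qed.

Lemma cartan_int a b : a \in Phi -> b \in Phi ->
  cartan_number dot a b = (Num.floor (cartan_number dot a b))%:~R.
Proof.
by move=> aP bP; have [_ _ _ h _] := hPhi; have /intrP[n ->] := h a b aP bP;
  rewrite intrKfloor.
Qed.

(** Every root is conjugate to a simple root under simple reflections.  A
positive root [b] that is not simple has [0 < dot (D i) b] for some [i]; the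
reflection in [D i] then lowers its height, and keeps it positive because it
leaves another positive coefficient unchanged. *)
Lemma root_ind (P : E -> Prop) : (forall i, P (D i)) ->
  (forall b i, b \in Phi -> P b -> P (refl (D i) b)) ->
  (forall b, b \in Phi -> P b -> P (- b)) ->
  forall b, b \in Phi -> P b.
Proof.
move=> h1 h2 h3; suff hpos b : pos b -> P b.
  move=> b bP; have [/hpos//|/hpos] := root_sign bP.
  by move=> /(h3 _ (opp_root bP)); rewrite opprK.
have [n] := ubnP (height b); elim: n b => // n IH b hb pb.
have bP := pos_root pb; have [i [bi dib]] := pos_dot_simple pb.
have iP := simple_root i.
have [->|nb] := eqVneq b (D i); first exact: h1.
have [j ji bj] := pos_other_coef pb nb.
have Erefl : refl (D i) b =
    b - (Num.floor (cartan_number dot (D i) b))%:~R *: D i.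
  by rewrite -cartan_int.
have k0 : 0 < Num.floor (cartan_number dot (D i) b).
  by rewrite -(ltr0z R) -cartan_int // divr_gt0 ?mulr_gt0 ?root_norm_gt0.
have rP := refl_root iP bP.
have pr : pos (refl (D i) b).
  apply: (pos_of_cf (i := j)) => //; rewrite Erefl.
  rewrite cfB ?cfZ; try exact: in_lattice_simple.
  - by rewrite cf_simple (negPf ji) mulr0 subr0.
  - exact: pos_lattice.
  - exact/in_latticeZ/in_lattice_simple.
rewrite -(reflK b iP).
apply: h2 => //; apply: IH => //.
by have := height_sub pb; rewrite Erefl in pr *; move=> /(_ _ _ pr); lia.
Qed.

Lemma simple_dot_le0 i j : i != j -> dot (D i) (D j) <= 0.
Proof.
move=> ij; rewrite leNgt; apply/negP => h.
have iL := in_lattice_simple i; have jL := in_lattice_simple j.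
have nij : D i != D j.
  apply: contraNneq ij => /(congr1 (fun x => cf x i)).
  by rewrite !cf_simple eqxx; case: (i == j).
have /root_sign[/(pos_cf i)|/(pos_cf j)] :=
    root_diff (simple_root i) (simple_root j) h nij.
  by rewrite cfB // !cf_simple eqxx (negPf ij).
by rewrite opprB cfB // !cf_simple eqxx eq_sym (negPf ij).
Qed.

Lemma simple_add_root i j : i != j -> dot (D i) (D j) != 0 -> D i + D j \in Phi.
Proof.
move=> ij d0; have jL := in_lattice_simple j.
have iP := simple_root i; have jP := simple_root j.
rewrite addrC -{1}(opprK (D i)).
apply: root_diff => //; first exact: opp_root.
- by rewrite linearNl /= oppr_gt0 lt_neqAle d0 simple_dot_le0.
- apply/eqP => /(congr1 (fun x => cf x j)).
  rewrite cfN ?cf_simple ?eqxx; first by case: (j == i).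
  exact: in_lattice_simple.
Qed.

Lemma cartan_matrixE i j :
  (cartan_matrix dot Delta i j)%:~R = cartan_number dot (D i) (D j).
Proof. by rewrite mxE -cartan_int // simple_root. Qed.

Lemma cartan_dot i j :
  (cartan_matrix dot Delta i j)%:~R * dot (D i) (D i) = 2 * dot (D i) (D j).
Proof.
rewrite cartan_matrixE /cartan_number divfK // gt_eqF // root_norm_gt0 //.
exact: simple_root.
Qed.

Lemma reflE i b : b \in Phi -> refl (D i) b =
  b - (\sum_j cartan_matrix dot Delta i j * cf b j)%:~R *: D i.
Proof.
move=> bP; rewrite /refl; congr (_ - _ *: _).
rewrite {1}(latticeE (root_in_lattice bP)) /cartan_number.
rewrite linear_sumr mulr_sumr mulr_suml.
rewrite rmorph_sum /=; apply: eq_bigr => j _.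
by rewrite dotZr rmorphM /= cartan_matrixE /cartan_number; ring.
Qed.

Lemma root_norm_simple b : b \in Phi -> exists i, dot b b = dot (D i) (D i).
Proof.
move: b; apply: root_ind => [i|b i bP|b bP]; first by exists i.
  by rewrite refl_norm // simple_root.
by rewrite linearNl linearNr /= opprK.
Qed.

(** By [root_norm_simple] the root lengths are those of the simple roots, so a
simple root is short as soon as it is shortest among the simple ones. *)
Lemma root_weightE (s : R) (d : 'I_r -> int) i0 :
  0 < s -> (forall i, d i = 1 \/ d i = 2) -> d i0 = 1 ->
  (forall i, dot (D i) (D i) = s * (d i)%:~R) ->
  forall i, root_weight dot Phi Delta i = d i.
Proof.
move=> s0 d12 di0 hd i; rewrite /root_weight /is_short_root.
have [di|di] := d12 i; rewrite di; last first.
  case: allP => // /(_ (D i0)) h; have := h (simple_root i0).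
  by rewrite !hd di di0 ler_pM2l // ler_int.
case: allP => // -[] b /root_norm_simple[j ->].
by rewrite !hd di ler_pM2l // ler_int; case: (d12 j) => ->.
Qed.

End RootLattice.

(** * Signs of a special Chevalley system and the form rho *)

Section Signs.
Variables (R : realType) (E : vectType R) (dot : {dot E for idfun}).
Variable Phi : {fset E}.
Hypothesis hPhi : is_root_system dot Phi.
Variables (r : nat) (Delta : r.-tuple E).
Hypothesis hDelta : is_simple_system Phi Delta.

Notation D i := (tnth Delta i).
Notation cf := (root_coef Delta).
Notation pos := (is_pos_root Phi Delta).
Notation A := (cartan_matrix dot Delta).

(** All that the proof retains of a special Chevalley system. *)
Record structure_signs (eps : E -> E -> int) (c : 'I_r -> int) : Prop := {
  signs_pm1 : forall a b, pos a -> pos b -> a + b \in Phi ->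
    eps a b = 1 \/ eps a b = -1;
  signs_skew : forall a b, pos a -> pos b -> a + b \in Phi ->
    eps a b = - eps b a;
  signs_simple : forall i b, pos b -> D i + b \in Phi -> eps (D i) b = c i;
  signs_jacobi : forall t x y z, pos x -> pos y -> pos z ->
    x + y \in Phi -> x + y + z \in Phi -> t = 1 \/ t = -1 ->
    (y + z \in Phi -> eps y z * eps x (y + z) = t) ->
    (x + z \in Phi -> - (eps x z * eps y (x + z)) = t) ->
    eps x y * eps (x + y) z = t
}.

Lemma special_structure_signs (L : lieAlgType R[i]) (H : {vspace L})
    (iota : E -> 'Hom(subvs_of H, R[i]^o)) (e : E -> L) eps c :
  is_root_identification Phi iota ->
  is_special_chevalley_system Phi iota e eps Delta c -> structure_signs eps c.
Proof.
move=> hiota [hch hsp]; split=> [a b pa pb abP | a b pa pb abP | i b pb ibP |].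
- exact: (eps_sign hch (pos_root pa) (pos_root pb) abP).
- refine (eps_skew hiota hch (pos_root pa) (pos_root pb) abP _).
  exact: (pos_add_neq0 hPhi hDelta pa pb).
- have [c1 _ hs _] := hsp i; have iP := simple_root hDelta i.
  have bP := pos_root pb; have biP : b + D i \in Phi by rewrite addrC.
  have [_ hlie] := hch; have [_] := hlie _ _ iP bP ibP.
  rewrite hs // addrC => /(eMz_inj hch ibP) /mulIf -> //.
- move=> t x y z px py pz xyP xyzP t1.
  apply: (eps_jacobi_sign hiota hch) => //.
  + exact: pos_root px.
  + exact: pos_root py.
  + exact: pos_root pz.
  + exact: (zero_not_root hPhi).
  + exact: (pos_add_neq0 hPhi hDelta py pz).
  + exact: (pos_add_neq0 hPhi hDelta px pz).
Qed.

Variables (eps : E -> E -> int) (c : 'I_r -> int).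
Hypothesis heps : structure_signs eps c.
Hypothesis hc : forall i, c i = 1 \/ c i = -1.

(** The sum of the two simple roots is a root, and both [eps (D i) (D j)] and
[eps (D j) (D i)] are prescribed. *)
Lemma simple_sign_alt i j : i != j -> A i j != 0 -> c i = - c j.
Proof.
move=> ij aij.
have ijP : D i + D j \in Phi.
  apply: (simple_add_root hPhi hDelta) => //; apply: contraNneq aij => d0.
  have := cartan_dot hPhi hDelta i j; rewrite d0 mulr0 => /eqP.
  rewrite mulf_eq0 intr_eq0 => /orP[//|].
  by rewrite gt_eqF // (root_norm_gt0 hPhi) // (simple_root hDelta).
have pi := pos_simple hDelta i; have pj := pos_simple hDelta j.
have jiP : D j + D i \in Phi by rewrite addrC.
by rewrite -(signs_simple heps pj ijP) -(signs_simple heps pi jiP)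
  (signs_skew heps).
Qed.

Variables (s : R) (d : 'I_r -> int) (i0 : 'I_r).
Hypothesis s0 : 0 < s.
Hypothesis hd1 : forall i, d i = 1 \/ d i = 2.
Hypothesis hdi0 : d i0 = 1.
Hypothesis hds : forall i, dot (D i) (D i) = s * (d i)%:~R.

(** The Gram matrix of the simple roots, scaled so that short roots have squared
length 2; in particular it is symmetric. *)
Definition gram (i j : 'I_r) : int := d i * A i j.

Lemma gram_dot i j : s * (gram i j)%:~R = 2 * dot (D i) (D j).
Proof.
by rewrite -(cartan_dot hPhi hDelta) hds /gram rmorphM /=; ring.
Qed.

Lemma gram_sym i j : gram i j = gram j i.
Proof.
apply/eqP; rewrite -(eqr_int R) -(inj_eq (mulfI (lt0r_neq0 s0))).
by rewrite !gram_dot dotC.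
Qed.

Lemma dot_gram a b : in_lattice Delta a -> in_lattice Delta b ->
  2 * dot a b = s * (\sum_i \sum_j gram i j * cf a i * cf b j)%:~R.
Proof.
move=> aL bL; rewrite {1}(latticeE hDelta aL) {1}(latticeE hDelta bL).
rewrite linear_sumlz /= rmorph_sum /= !mulr_sumr; apply: eq_bigr => i _.
rewrite linear_sumr /= rmorph_sum /= !mulr_sumr; apply: eq_bigr => j _.
rewrite dotZl dotZr !intrM.
transitivity ((cf a i)%:~R * (cf b j)%:~R * (2 * dot (D i) (D j))); first by ring.
by rewrite -gram_dot /gram intrM; ring.
Qed.

Notation rho := (rho_vec dot Phi Delta c).

Lemma rhoE a b : rho a b = \sum_i \sum_j
  (if (i != j) && (c i == -1) then gram i j else 0) * cf a i * cf b j.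
Proof.
rewrite /rho_vec; apply: eq_bigr => i _; rewrite big_mkcond /=.
apply: eq_bigr => j _; rewrite (root_weightE hPhi hDelta s0 hd1 hdi0 hds).
rewrite /gram; case: (i != j) => /=; last by rewrite !mul0r.
case: (c i == -1); rewrite ?andbF ?andbT; last by rewrite !mul0r.
by case: eqP => //= ->; rewrite mulr0 !mul0r.
Qed.

Lemma rhoE_swap a b : rho b a = \sum_i \sum_j
  (if (i != j) && (c j == -1) then gram i j else 0) * cf a i * cf b j.
Proof.
rewrite rhoE exchange_big; apply: eq_bigr => i _; apply: eq_bigr => j _.
by rewrite eq_sym gram_sym; ring.
Qed.

Lemma gram_sign i j : i != j -> gram i j != 0 -> c i = - c j.
Proof.
move=> ij; rewrite /gram mulf_eq0 negb_or => /andP[_].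
exact: simple_sign_alt.
Qed.

(** For adjacent nodes exactly one of [c i] and [c j] is -1, so each ordered pair
of nodes contributes to exactly one of the two terms. *)
Lemma rho_add a b : rho a b + rho b a = \sum_i \sum_j
  (if i != j then gram i j else 0) * cf a i * cf b j.
Proof.
rewrite rhoE rhoE_swap -big_split; apply: eq_bigr => i _ /=.
rewrite -big_split; apply: eq_bigr => j _ /=.
have [_|ij] := eqVneq i j => /=; first by rewrite !mul0r.
have [->|/(gram_sign ij) cij] := eqVneq (gram i j) 0.
  by rewrite !if_same !mul0r.
by rewrite /= cij; case: (hc j) => -> /=; rewrite ?mul0r ?addr0 ?add0r.
Qed.

Lemma rho_sub a b : rho a b - rho b a = - \sum_i \sum_j
  (if i != j then c i * gram i j else 0) * cf a i * cf b j.
Proof.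
rewrite rhoE rhoE_swap -sumrB -sumrN; apply: eq_bigr => i _ /=.
rewrite -sumrB -sumrN; apply: eq_bigr => j _ /=.
have [_|ij] := eqVneq i j => /=; first by rewrite !mul0r subrr oppr0.
have [->|/(gram_sign ij) cij] := eqVneq (gram i j) 0.
  by rewrite !if_same !mulr0 !mul0r oppr0 subrr.
by rewrite /= cij; case: (hc j) => -> /=; ring.
Qed.

Lemma rhoDl a b x : in_lattice Delta a -> in_lattice Delta b ->
  rho (a + b) x = rho a x + rho b x.
Proof.
move=> aL bL; rewrite !rhoE -big_split; apply: eq_bigr => i _ /=.
rewrite -big_split; apply: eq_bigr => j _ /=; rewrite cfD //; ring.
Qed.

Lemma rhoDr a b x : in_lattice Delta a -> in_lattice Delta b ->
  rho x (a + b) = rho x a + rho x b.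
Proof.
move=> aL bL; rewrite !rhoE -big_split; apply: eq_bigr => i _ /=.
rewrite -big_split; apply: eq_bigr => j _ /=; rewrite cfD //; ring.
Qed.

End Signs.

(** * Root lengths in types B and C *)

Lemma ord_down_ind r (P : 'I_r -> Prop) :
  (forall i : 'I_r, i.+1 = r -> P i) ->
  (forall i j : 'I_r, i.+1 = j -> P j -> P i) -> forall i, P i.
Proof.
move=> hl hs i; have [n] := ubnP (r - i)%N; elim: n i => // n IH i hn.
have ir := ltn_ord i; have [ir'|ir'] := ltnP i.+1 r.
  by apply: (hs i (Ordinal ir')) => //; apply: IH => /=; lia.
by apply: hl; lia.
Qed.

(** Squared lengths of the simple roots in types B and C, relative to the short
ones. *)
Definition weight_B r (i : 'I_r) : int := if i.+1 == r then 1 else 2.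
Definition weight_C r (i : 'I_r) : int := if i.+1 == r then 2 else 1.

Section ChainNorms.
Variables (R : realType) (E : vectType R) (dot : {dot E for idfun}).
Variable Phi : {fset E}.
Hypothesis hPhi : is_root_system dot Phi.
Variables (r : nat) (Delta : r.-tuple E).
Hypothesis hDelta : is_simple_system Phi Delta.
Hypothesis hr : (2 <= r)%N.
Notation D i := (tnth Delta i).
Notation A := (cartan_matrix dot Delta).

Lemma cartan_norm_ratio i j :
  (A i j)%:~R * dot (D i) (D i) = (A j i)%:~R * dot (D j) (D j).
Proof. by rewrite !(cartan_dot hPhi hDelta) dotC. Qed.

Lemma last_lt : (r.-1 < r)%N. Proof. by lia. Qed.

(** The Cartan entries of adjacent nodes give the ratios of their squared lengths;
these are propagated from the end of the chain, where the double edge is. *)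
Lemma norm_B : A = cartan_B r -> exists2 s : R, 0 < s &
  forall i, dot (D i) (D i) = s * (weight_B i)%:~R.
Proof.
move=> hA; pose l := Ordinal last_lt.
exists (dot (D l) (D l)); first exact: (root_norm_gt0 hPhi (simple_root hDelta l)).
apply: ord_down_ind => [i il|i j ij IH].
  have -> : i = l by apply: val_inj => /=; lia.
  by rewrite /weight_B /= prednK ?eqxx ?mulr1 //; lia.
have := cartan_norm_ratio i j; rewrite IH hA !mxE /weight_B -ij.
have jr := ltn_ord j.
have -> : (i == i.+1 :> nat) = false by lia.
have -> : (i.+1 == i :> nat) = false by lia.
have -> : (i.+2 == i :> nat) = false by lia.
have -> : (i.+1 == r) = false by lia.
rewrite eqxx; case: ifP => _ /=; lra.
Qed.

Lemma norm_C : A = cartan_C r -> exists2 s : R, 0 < s &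
  forall i, dot (D i) (D i) = s * (weight_C i)%:~R.
Proof.
move=> hA; pose l := Ordinal last_lt.
exists (dot (D l) (D l) / 2).
  by rewrite divr_gt0 // (root_norm_gt0 hPhi (simple_root hDelta l)).
apply: ord_down_ind => [i il|i j ij IH].
  have -> : i = l by apply: val_inj => /=; lia.
  by rewrite /weight_C /= prednK ?eqxx; [field | lia].
have := cartan_norm_ratio i j; rewrite IH hA !mxE /weight_C -ij.
have jr := ltn_ord j.
have -> : (i == i.+1 :> nat) = false by lia.
have -> : (i.+1 == i :> nat) = false by lia.
have -> : (i.+2 == i :> nat) = false by lia.
have -> : (i.+1 == r) = false by lia.
rewrite eqxx; case: ifP => _ /=; lra.
Qed.

End ChainNorms.

(** * Type B *)

Definition adjacent r (i j : 'I_r) : bool := (i.+1 == j) || (j.+1 == i).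

Lemma sum_adjacent_even r (n : 'I_r -> int) :
  exists k, \sum_i \sum_j (adjacent i j)%:R * n i * n j = 2 * k.
Proof.
exists (\sum_(i : 'I_r) \sum_(j : 'I_r) (i.+1 == j)%:R * n i * n j).
rewrite mulr_natl mulr2n; rewrite [X in _ = _ + X]exchange_big -big_split.
apply: eq_bigr => i _ /=; rewrite -big_split; apply: eq_bigr => j _ /=.
rewrite /adjacent; have [ij|ij] := eqVneq i.+1 j; have [ji|ji] := eqVneq j.+1 i.
- by lia.
- by rewrite /=; ring.
- by rewrite /=; ring.
- by rewrite /=; ring.
Qed.

(** The arithmetic behind [pairing_odd]: [xa] and [xb] stand for the coefficients
of two roots on the short simple root, the two long expressions for their
squared lengths, [nab] for that of their sum, and [x] for the symmetrized
pairing.  Each squared length fixes the parity of [xa] or [xb], and in every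
case the inner product [xa * xb + 2 * kab - x] is forced. *)
Lemma odd_of_norms (nab ka kb kab ja jb x xa xb : int) :
  nab = 1 \/ nab = 2 ->
  xb * xb + 2 * kb - 2 * jb = 1 \/ xb * xb + 2 * kb - 2 * jb = 2 ->
  xa * xa + 2 * ka - 2 * ja = 1 \/ xa * xa + 2 * ka - 2 * ja = 2 ->
  nab = xa * xa + 2 * ka - 2 * ja + (xb * xb + 2 * kb - 2 * jb) +
    2 * (xa * xb + 2 * kab - x) ->
  exists k, x = 2 * k + 1.
Proof.
have odd_split (y : int) : exists p u, y = 2 * p + u /\ (u = 0 \/ u = 1).
  by exists (y %/ 2)%Z, (y %% 2)%Z; lia.
have [p [u [-> u01]]] := odd_split xa; have [q [v [-> v01]]] := odd_split xb.
have -> : (2 * p + u) * (2 * p + u) = 2 * (2 * p * p + 2 * p * u) + u * u by ring.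
have -> : (2 * q + v) * (2 * q + v) = 2 * (2 * q * q + 2 * q * v) + v * v by ring.
have -> : (2 * p + u) * (2 * q + v) = 2 * (2 * p * q + p * v + u * q) + u * v.
  by ring.
move: (2 * p * p + _) (2 * q * q + _) (2 * p * q + _ + _) => P Q S h1 h2 h3 h4.
exists ((x - 1) %/ 2)%Z.
by case: u01 h3 h4 => ->; case: v01 h2 => ->; lia.
Qed.

Definition parity_sign (z : int) : int := (-1) ^ z.

Lemma parity_signD x y : parity_sign (x + y) = parity_sign x * parity_sign y.
Proof. by rewrite /parity_sign exprzDr // unitrN1. Qed.

Lemma parity_sign_pm1 z : parity_sign z = 1 \/ parity_sign z = -1.
Proof.
case: z => n; rewrite /parity_sign; first rewrite -exprnP.
  by rewrite -signr_odd; case: odd; [right | left].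
by rewrite NegzE -exprnN -signr_odd; case: odd; [right | left].
Qed.

Lemma parity_sign_odd k : parity_sign (2 * k + 1) = -1.
Proof.
rewrite parity_signD mulr_natl mulr2n parity_signD.
by case: (parity_sign_pm1 k) => ->.
Qed.

Section TypeB.
Variables (R : realType) (E : vectType R) (dot : {dot E for idfun}).
Variable Phi : {fset E}.
Hypothesis hPhi : is_root_system dot Phi.
Variables (r : nat) (Delta : r.-tuple E).
Hypothesis hDelta : is_simple_system Phi Delta.
Hypothesis hr : (2 <= r)%N.
Notation D i := (tnth Delta i).
Notation A := (cartan_matrix dot Delta).
Notation cf := (root_coef Delta).
Notation pos := (is_pos_root Phi Delta).
Variables (eps : E -> E -> int) (c : 'I_r -> int).
Hypothesis heps : structure_signs Phi Delta eps c.
Hypothesis hc : forall i, c i = 1 \/ c i = -1.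
Hypothesis hA : A = cartan_B r.
Notation rho := (rho_vec dot Phi Delta c).

Let l := Ordinal (last_lt hr).
Let norm_data := norm_B hPhi hDelta hr hA.

Lemma weight_B12 (i : 'I_r) : weight_B i = 1 \/ weight_B i = 2.
Proof. by rewrite /weight_B; case: ifP; [left | right]. Qed.

Lemma weight_B_last : weight_B l = 1.
Proof. by rewrite /weight_B /= prednK ?eqxx //; lia. Qed.

Lemma weight_B_neq i : i != l -> weight_B i = 2.
Proof.
move=> il; rewrite /weight_B; case: eqP => // ir.
by case/eqP: il; apply: val_inj => /=; lia.
Qed.

Notation gram := (gram dot Delta (@weight_B r)).

Lemma gram_B i j : i != j -> gram i j = -2 * (adjacent i j)%:R.
Proof.
rewrite /gram hA mxE /adjacent /weight_B -val_eqE /= => /negPf ->.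
have := ltn_ord j; case: (eqVneq i.+1 j) => [ij|_] jr /=.
  by have -> : (i.+1 == r) = false by lia.
by case: eqP => _; case: eqP => _; rewrite ?mulr0.
Qed.

Lemma gram_B_diag i : gram i i = 2 * weight_B i.
Proof. by rewrite /gram hA mxE eqxx mulrC. Qed.

(** The form written f in the introduction. *)
Definition pairing (a b : E) : int := \sum_i \sum_j
  (adjacent i j && (c i == -1))%:R * cf a i * cf b j.

(** The inner product, scaled so that short roots have squared length 1. *)
Definition half_form (a b : E) : int :=
  \sum_i weight_B i * cf a i * cf b i -
  \sum_i \sum_j (adjacent i j)%:R * cf a i * cf b j.

Lemma adjacent_irr (i : 'I_r) : adjacent i i = false.
Proof. by rewrite /adjacent; lia. Qed.

Lemma dot_half_form s : 0 < s ->
  (forall i, dot (D i) (D i) = s * (weight_B i)%:~R) ->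
  forall a b, in_lattice Delta a -> in_lattice Delta b ->
  dot a b = s * (half_form a b)%:~R.
Proof.
move=> s0 hs a b aL bL; have := dot_gram hPhi hDelta hs aL bL.
suff -> : \sum_i \sum_j gram i j * cf a i * cf b j = 2 * half_form a b.
  by rewrite intrM => h; apply: (@mulfI R 2); rewrite ?pnatr_eq0 // h; ring.
rewrite /half_form mulrBr !mulr_sumr -sumrB; apply: eq_bigr => i _.
rewrite mulr_sumr (bigD1 i) //= [in RHS](bigD1 i) //= adjacent_irr !mul0r.
rewrite mulr0 add0r gram_B_diag -!mulrA; congr (_ + _); rewrite -sumrN.
by apply: eq_bigr => j ji; rewrite gram_B 1?eq_sym //; ring.
Qed.

Lemma half_form_norm a : a \in Phi -> half_form a a = 1 \/ half_form a a = 2.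
Proof.
have [s s0 hs] := norm_data.
move=> aP; have aL := root_in_lattice hDelta aP.
have := dot_half_form s0 hs aL aL.
have [i ->] := root_norm_simple hPhi hDelta aP; rewrite hs.
move/(mulfI (lt0r_neq0 s0))/eqP; rewrite eqr_int => /eqP <-.
exact: weight_B12.
Qed.

Lemma weight_sum_mod2 a b : exists k,
  \sum_i weight_B i * cf a i * cf b i = cf a l * cf b l + 2 * k.
Proof.
exists (\sum_(i | i != l) cf a i * cf b i).
rewrite (bigD1 l) //= weight_B_last mul1r mulr_sumr; congr (_ + _).
by apply: eq_bigr => i il; rewrite weight_B_neq // mulrA.
Qed.

Lemma half_formD a b : in_lattice Delta a -> in_lattice Delta b ->
  half_form (a + b) (a + b) =
  half_form a a + half_form b b + 2 * half_form a b.
Proof.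
have [s s0 hs] := norm_data.
move=> aL bL; have abL := in_latticeD aL bL.
have : dot (a + b) (a + b) = dot a a + dot b b + 2 * dot a b.
  by rewrite linearDl !linearDr /= (dotC dot b a); ring.
rewrite !(dot_half_form s0 hs) // mulrCA -!mulrDr => /(mulfI (lt0r_neq0 s0)).
by rewrite -[2]/(2%:~R) -intrM -!intrD => /eqP; rewrite eqr_int => /eqP.
Qed.

Lemma rho_pairing a b : rho a b = - 2 * pairing a b.
Proof.
have [s s0 hs] := norm_data.
rewrite (rhoE hPhi hDelta c s0 weight_B12 weight_B_last hs) /pairing mulr_sumr.
apply: eq_bigr => i _; rewrite mulr_sumr; apply: eq_bigr => j _.
have [<-|ij] := eqVneq i j; first by rewrite adjacent_irr /= !mul0r mulr0.
rewrite gram_B //=; case: (c i == -1); rewrite ?andbT ?andbF /=; ring.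
Qed.

(** The symmetrized pairing is, up to sign, the edge part of the inner product.  In each of the
squared lengths of [a] and [b] the edge part is even by symmetry, and the
diagonal part reduces mod 2 to the coefficient of the short simple root. *)
Lemma pairing_odd a b : a \in Phi -> b \in Phi -> a + b \in Phi ->
  exists k, pairing a b + pairing b a = 2 * k + 1.
Proof.
move=> aP bP abP; have [s s0 hs] := norm_data.
have aL := root_in_lattice hDelta aP; have bL := root_in_lattice hDelta bP.
have Esum : pairing a b + pairing b a =
    \sum_i \sum_j (adjacent i j)%:R * cf a i * cf b j.
  have := rho_add hPhi hDelta heps hc s0 weight_B12 weight_B_last hs a b.
  rewrite !rho_pairing -mulrDr.
  set X := \sum_i _; suff -> : X = - 2 * \sum_i \sum_j (adjacent i j)%:R * cf a i * cf b j.
    by move/mulfI; apply.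
  rewrite /X mulr_sumr; apply: eq_bigr => i _; rewrite mulr_sumr.
  apply: eq_bigr => j _; have [<-|ij] := eqVneq i j.
    by rewrite adjacent_irr /= !mul0r mulr0.
  by rewrite gram_B //=; ring.
have := half_formD aL bL.
have [ka hka] := weight_sum_mod2 a a; have [kb hkb] := weight_sum_mod2 b b.
have [kab hkab] := weight_sum_mod2 a b.
have [ja hja] := sum_adjacent_even (cf a).
have [jb hjb] := sum_adjacent_even (cf b).
have := half_form_norm aP; have := half_form_norm bP.
have := half_form_norm abP.
move: (half_form (a + b) _) => nab.
rewrite /half_form hka hkb hkab hja hjb -Esum.
exact: odd_of_norms.
Qed.

Lemma pairingDl a b x : in_lattice Delta a -> in_lattice Delta b ->
  pairing (a + b) x = pairing a x + pairing b x.
Proof.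
move=> aL bL; rewrite /pairing -big_split; apply: eq_bigr => i _ /=.
by rewrite -big_split; apply: eq_bigr => j _ /=; rewrite cfD //; ring.
Qed.

Lemma pairingDr a b x : in_lattice Delta a -> in_lattice Delta b ->
  pairing x (a + b) = pairing x a + pairing x b.
Proof.
move=> aL bL; rewrite /pairing -big_split; apply: eq_bigr => i _ /=.
by rewrite -big_split; apply: eq_bigr => j _ /=; rewrite cfD //; ring.
Qed.

Lemma parity_sign_pairing_skew a b : a \in Phi -> b \in Phi -> a + b \in Phi ->
  parity_sign (pairing a b) = - parity_sign (pairing b a).
Proof.
move=> aP bP abP; have [k] := pairing_odd aP bP abP.
move/(congr1 parity_sign); rewrite parity_signD parity_sign_odd.
by case: (parity_sign_pm1 (pairing a b)) (parity_sign_pm1 (pairing b a)) => -> [] ->.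
Qed.

Lemma pairing_eq0 i b : c i = 1 -> pairing (D i) b = 0.
Proof.
move=> ci; rewrite /pairing big1 // => k _; rewrite big1 // => j _.
rewrite (cf_simple hDelta); have [->|_] := eqVneq k i.
  by rewrite ci andbF !mul0r.
by rewrite mulr0 mul0r.
Qed.

Lemma pairing_eq0_swap i b : c i = -1 -> pairing b (D i) = 0.
Proof.
have [s s0 hs] := norm_data.
move=> ci; rewrite /pairing big1 // => k _; rewrite big1 // => j _.
rewrite (cf_simple hDelta); have [->|_] := eqVneq j i; last by rewrite mulr0.
have [->|ki] := eqVneq k i; first by rewrite adjacent_irr !mul0r.
have [ad|_] := boolP (adjacent k i); last by rewrite !mul0r.
suff -> : c k = 1 by rewrite !mul0r.
have := gram_sign hPhi hDelta heps (d := @weight_B r) ki.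
by rewrite gram_B // ad ci => ->.
Qed.

(** If [c i = 1] no edge leaves [i], and the pairing vanishes; if [c i = -1] no edge
enters [i], and the pairing equals its symmetrization, which is odd. *)
Lemma signs_simple_B i b : pos b -> D i + b \in Phi ->
  eps (D i) b = parity_sign (pairing (D i) b).
Proof.
move=> pb ibP; rewrite (signs_simple heps pb ibP).
have [ci|ci] := hc i; rewrite ci; first by rewrite pairing_eq0.
have [k] := pairing_odd (simple_root hDelta i) (pos_root pb) ibP.
by rewrite pairing_eq0_swap // addr0 => ->; rewrite parity_sign_odd.
Qed.

(** Induction on the height of [a]: write [a = D i + a'] with [a'] a positive root
and compare the two terms of the Jacobi identity for [D i], [a'] and [b]. *)
Lemma signs_type_B a b : pos a -> pos b -> a + b \in Phi ->
  eps a b = parity_sign (pairing a b).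
Proof.
have [n] := ubnP (height Delta a); elim: n a b => // n IH a b hn pa pb abP.
have [[i Ea]|[i pa']] := pos_sub_simple hPhi hDelta pa.
  by rewrite Ea; apply: signs_simple_B; rewrite // -Ea.
set a' := a - D i in pa'.
have Ea : D i + a' = a by rewrite /a' addrC subrK.
have pi := pos_simple hDelta i.
have iL := pos_lattice hDelta pi; have a'L := pos_lattice hDelta pa'.
have bL := pos_lattice hDelta pb.
have iP := pos_root pi; have a'P := pos_root pa'; have bP := pos_root pb.
have hn' : (height Delta a' < n)%N.
  have := height_sub hDelta pa (i := i) (n := 1).
  by rewrite scale1r => /(_ pa'); rewrite -/a'; lia.
have aP : D i + a' \in Phi by rewrite Ea; exact: pos_root pa.
clearbody a'.
have sgn1 := signs_simple_B pa' aP.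
suff : eps (D i) a' * eps (D i + a') b =
    parity_sign (pairing (D i) a') * parity_sign (pairing a b).
  rewrite Ea sgn1 => /mulfI; apply.
  by case: (parity_sign_pm1 (pairing (D i) a')) => ->.
apply: (signs_jacobi heps) => //; rewrite ?Ea //.
- exact: signM (parity_sign_pm1 _) (parity_sign_pm1 _).
- move=> a'bP; have i_a'b : D i + (a' + b) \in Phi by rewrite addrA Ea.
  rewrite (IH a' b) // signs_simple_B //; last exact: posD.
  rewrite -Ea pairingDl // pairingDr // !parity_signD; ring.
- move=> ibP; have a'_ib : a' + (D i + b) \in Phi by rewrite addrCA addrA Ea.
  rewrite (IH a' (D i + b)) //; last exact: posD.
  rewrite signs_simple_B // -Ea pairingDl // pairingDr // !parity_signD.
  rewrite (parity_sign_pairing_skew iP a'P aP); ring.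
Qed.

Corollary rho_type_B a b : pos a -> pos b -> a + b \in Phi ->
  (2 %| rho a b)%Z /\ eps a b = (-1) ^ (rho a b %/ 2)%Z.
Proof.
move=> pa pb abP; rewrite rho_pairing mulNr -mulrN; split; first exact: dvdz_mulr.
rewrite mulKz // (signs_type_B pa pb abP) /parity_sign.
by rewrite -exprz_inv invrN1.
Qed.

End TypeB.

(** * Coordinates of the roots in type C *)

Lemma sum_split2 r (F : nat -> int) p q : (p < r)%N -> (q < r)%N -> p != q ->
  \sum_(k < r) F k =
  F p + F q + \sum_(k < r | (k != p :> nat) && (k != q :> nat)) F k.
Proof.
move=> pr qr pq; rewrite (bigD1 (Ordinal pr)) //= (bigD1 (Ordinal qr)) /=.
  by rewrite addrA.
by rewrite -val_eqE /= eq_sym.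
Qed.

Lemma sum_split3 r (F : nat -> int) p q s : (p < r)%N -> (q < r)%N ->
  (s < r)%N -> p != q -> p != s -> q != s ->
  \sum_(k < r) F k = F p + F q + F s +
  \sum_(k < r | [&& k != p :> nat, k != q :> nat & k != s :> nat]) F k.
Proof.
move=> pr qr sr pq ps qs; rewrite (sum_split2 F pr qr pq).
rewrite (bigD1 (Ordinal sr)) /=; last by rewrite !(eq_sym s) ps qs.
by rewrite !addrA; congr (_ + _); apply: eq_bigl => k; rewrite -val_eqE andbA.
Qed.

Section TypeC.
Variables (R : realType) (E : vectType R) (dot : {dot E for idfun}).
Variable Phi : {fset E}.
Hypothesis hPhi : is_root_system dot Phi.
Variables (r : nat) (Delta : r.-tuple E).
Hypothesis hDelta : is_simple_system Phi Delta.
Notation D i := (tnth Delta i).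
Notation A := (cartan_matrix dot Delta).
Notation cf := (root_coef Delta).
Notation pos := (is_pos_root Phi Delta).
Hypothesis hA : A = cartan_C r.

(** In the basis e_0, e_1, ... of the introduction, the coefficient of [b] on the
k-th simple root is the sum of its first k+1 coordinates, or half of it for the
last simple root; whence the weight. *)
Definition psum (b : E) (k : nat) : int :=
  \sum_(i < r) (i == k :> nat)%:R * (weight_C i * cf b i).

Definition psum_prev (b : E) (k : nat) : int :=
  if k is k'.+1 then psum b k' else 0.

(** The coordinate of [b] on e_k. *)
Definition ecoord (b : E) (k : nat) : int := psum b k - psum_prev b k.

Definition ell1 (b : E) : int := \sum_(k < r) `|ecoord b k|.

Lemma psumE b (i : 'I_r) : psum b i = weight_C i * cf b i.
Proof.
rewrite /psum (bigD1 i) //= eqxx mul1r big1 ?addr0 // => j ji.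
by rewrite val_eqE (negPf ji) mul0r.
Qed.

Lemma psumD a b k : in_lattice Delta a -> in_lattice Delta b ->
  psum (a + b) k = psum a k + psum b k.
Proof.
move=> aL bL; rewrite /psum -big_split; apply: eq_bigr => i _ /=.
by rewrite cfD //; ring.
Qed.

Lemma psumN a k : in_lattice Delta a -> psum (- a) k = - psum a k.
Proof.
move=> aL; rewrite /psum -sumrN; apply: eq_bigr => i _ /=.
by rewrite cfN //; ring.
Qed.

Lemma psumZ (n : int) a k : in_lattice Delta a ->
  psum (n%:~R *: a) k = n * psum a k.
Proof.
move=> aL; rewrite /psum mulr_sumr; apply: eq_bigr => i _ /=.
by rewrite cfZ //; ring.
Qed.

Lemma ecoordD a b k : in_lattice Delta a -> in_lattice Delta b ->
  ecoord (a + b) k = ecoord a k + ecoord b k.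
Proof.
move=> aL bL; rewrite /ecoord /psum_prev psumD //.
by case: k => [|k]; rewrite ?psumD //; ring.
Qed.

Lemma ecoordN a k : in_lattice Delta a -> ecoord (- a) k = - ecoord a k.
Proof.
move=> aL; rewrite /ecoord /psum_prev psumN //.
by case: k => [|k]; rewrite ?psumN //; ring.
Qed.

Lemma ecoordZ (n : int) a k : in_lattice Delta a ->
  ecoord (n%:~R *: a) k = n * ecoord a k.
Proof.
move=> aL; rewrite /ecoord /psum_prev psumZ //.
by case: k => [|k]; rewrite ?psumZ //; ring.
Qed.

Lemma ecoord_sub (n : int) a b k : in_lattice Delta a -> in_lattice Delta b ->
  ecoord (b - n%:~R *: a) k = ecoord b k - n * ecoord a k.
Proof.
move=> aL bL; have naL := in_latticeZ n aL.
by rewrite ecoordD ?ecoordN ?ecoordZ //; exact: in_latticeN.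
Qed.

Lemma psum_simple (i : 'I_r) k :
  psum (D i) k = (k == i :> nat)%:R * weight_C i.
Proof.
rewrite /psum (bigD1 i) //= (cf_simple hDelta) eqxx mulr1 eq_sym.
rewrite big1 ?addr0 // => j ji.
by rewrite (cf_simple hDelta) (negPf ji) !mulr0.
Qed.

Lemma ecoord_simple (i : 'I_r) k : i.+1 != r ->
  ecoord (D i) k = (k == i :> nat)%:R - (k == i.+1 :> nat)%:R.
Proof.
move=> ir; rewrite /ecoord /psum_prev psum_simple /weight_C (negPf ir) mulr1.
by case: k => [|k] //; rewrite psum_simple /weight_C (negPf ir) mulr1 eqSS.
Qed.

Lemma ecoord_simple_last (i : 'I_r) k : i.+1 = r -> (k < r)%N ->
  ecoord (D i) k = 2 * (k == i :> nat)%:R.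
Proof.
move=> ir kr; rewrite /ecoord /psum_prev psum_simple /weight_C ir eqxx mulrC.
case: k kr => [|k] kr //; first by rewrite subr0.
rewrite psum_simple; have -> : (k == i :> nat) = false by lia.
by rewrite mul0r subr0.
Qed.

Lemma ecoord_inj a b : in_lattice Delta a -> in_lattice Delta b ->
  (forall k, (k < r)%N -> ecoord a k = ecoord b k) -> a = b.
Proof.
move=> aL bL hab; apply: (cf_inj hDelta) => // i.
have key k : (k < r)%N -> psum a k = psum b k.
  elim: k => [|k IH] kr; have := hab _ kr; rewrite /ecoord /psum_prev.
    by rewrite !subr0.
  by rewrite IH ?(ltnW kr) // => /addIr.
have := key i (ltn_ord i); rewrite !psumE.
by rewrite /weight_C; case: ifP => _; lia.
Qed.

Lemma psum_sum b k : psum b k = \sum_(j < k.+1) ecoord b j.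
Proof.
elim: k => [|k IH]; first by rewrite big_ord_recl big_ord0 addr0 /ecoord subr0.
by rewrite big_ord_recr -IH /= /ecoord /psum_prev addrC subrK.
Qed.

Lemma sum_psum_delta b k : \sum_(j < r) (j == k :> nat)%:R * psum b j = psum b k.
Proof.
by rewrite /psum; apply: eq_bigr => j _; rewrite -psumE /psum; case: eqP.
Qed.

Lemma sum_psum_delta_prev b k :
  \sum_(j < r) (j.+1 == k)%:R * psum b j = psum_prev b k.
Proof.
case: k => [|k]; first by rewrite big1 // => j _; rewrite mul0r.
exact: sum_psum_delta.
Qed.

(** In these coordinates a simple reflection other than the last exchanges two
consecutive coordinates, and the last one changes the sign of the last
coordinate.  The next two lemmas compute the Cartan integers involved. *)
Lemma cartan_row_inner (i : 'I_r) b : i.+1 != r ->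
  \sum_j A i j * cf b j = ecoord b i - ecoord b i.+1.
Proof.
move=> ir; rewrite /ecoord /= -(sum_psum_delta b i) -(sum_psum_delta b i.+1).
rewrite -(sum_psum_delta_prev b i) -!sumrB; apply: eq_bigr => j _.
rewrite hA !mxE psumE /weight_C; have jr := ltn_ord j; have ir0 := ltn_ord i.
have [->|ij] := eqVneq (j : nat) i.
  have -> : (i.+1 == i :> nat) = false by lia.
  have -> : (i == i.+1 :> nat) = false by lia.
  by rewrite (negPf ir) /=; ring.
have [Ej|ji] := eqVneq j.+1 i.
  have -> : (j == i.+1 :> nat) = false by lia.
  have -> : (j.+1 == r) = false by lia.
  by rewrite /=; ring.
rewrite (eq_sym i.+1); case: eqP => /= _; last by ring.
by case: eqP => _; ring.
Qed.

Lemma cartan_row_last (i : 'I_r) b : i.+1 = r ->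
  \sum_j A i j * cf b j = ecoord b i.
Proof.
move=> ir; rewrite /ecoord /= -(sum_psum_delta b i).
rewrite -(sum_psum_delta_prev b i) -!sumrB; apply: eq_bigr => j _.
rewrite hA !mxE psumE /weight_C; have jr := ltn_ord j; have ir0 := ltn_ord i.
have [->|ij] := eqVneq (j : nat) i.
  have -> : (i.+1 == i :> nat) = false by lia.
  by rewrite ir eqxx /=; ring.
have [Ej|ji] := eqVneq j.+1 i.
  have -> : (j.+1 == r) = false by lia.
  by rewrite /=; ring.
have -> : (i.+1 == j :> nat) = false by lia.
by rewrite /=; ring.
Qed.

Lemma ecoord_refl_inner (i : 'I_r) b k : i.+1 != r -> b \in Phi ->
  ecoord (refl dot (D i) b) k =
  if k == i then ecoord b i.+1 else if k == i.+1 then ecoord b i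
  else ecoord b k.
Proof.
move=> ir bP; have bL := root_in_lattice hDelta bP.
have iL := in_lattice_simple hDelta i.
rewrite (reflE hPhi hDelta) // cartan_row_inner //.
rewrite ecoord_sub //.
rewrite ecoord_simple //; have [->|ki] := eqVneq k i.
  have -> : (i == i.+1 :> nat) = false by lia.
  by rewrite /=; ring.
by have [->|kj] := eqVneq k i.+1; rewrite /=; ring.
Qed.

Lemma ecoord_refl_last (i : 'I_r) b k : i.+1 = r -> (k < r)%N -> b \in Phi ->
  ecoord (refl dot (D i) b) k = if k == i then - ecoord b i else ecoord b k.
Proof.
move=> ir kr bP; have bL := root_in_lattice hDelta bP.
have iL := in_lattice_simple hDelta i.
rewrite (reflE hPhi hDelta) // cartan_row_last //.
rewrite ecoord_sub //.
rewrite ecoord_simple_last //; by have [->|ki] := eqVneq k i; rewrite /=; ring.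
Qed.

(** The simple reflections permute coordinates up to sign, so it is enough to look
at the simple roots. *)
Lemma root_ell1 b : b \in Phi -> ell1 b = 2.
Proof.
move: b; apply: (root_ind hPhi hDelta) => [i|b i bP IH|b bP IH].
- have ir := ltn_ord i; have [ir'|ir'] := eqVneq i.+1 r.
    rewrite /ell1 (bigD1 i) //= ecoord_simple_last // eqxx big1 ?addr0 //.
    move=> k ki; rewrite ecoord_simple_last // val_eqE (negPf ki) mulr0.
    exact: normr0.
  have ir2 : (i.+1 < r)%N by lia.
  rewrite /ell1 (sum_split2 (fun k => `|ecoord (D i) k|) ir ir2); last by lia.
  rewrite !ecoord_simple // !eqxx big1 => [|k /andP[k1 k2]].
    have -> : (i == i.+1 :> nat) = false by lia.
    by have -> : (i.+1 == i :> nat) = false by lia.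
  by rewrite ecoord_simple // (negPf k1) (negPf k2) normr0.
- rewrite -IH; have ir := ltn_ord i; have [ir'|ir'] := eqVneq i.+1 r.
    apply: eq_bigr => k _; rewrite ecoord_refl_last //.
    by case: eqP => // ->; rewrite normrN.
  have ir2 : (i.+1 < r)%N by lia.
  have ii : (i : nat) != i.+1 by lia.
  rewrite /ell1 (sum_split2 (fun k => `|ecoord (refl dot (D i) b) k|) ir ir2) //.
  rewrite (sum_split2 (fun k => `|ecoord b k|) ir ir2) //.
  rewrite !ecoord_refl_inner // !eqxx.
  have -> : (i.+1 == i :> nat) = false by lia.
  congr (_ + _); first exact: addrC.
  apply: eq_bigr => k /andP[k1 k2].
  by rewrite ecoord_refl_inner // (negPf k1) (negPf k2).
- rewrite -IH; apply: eq_bigr => k _.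
  by rewrite ecoordN ?normrN //; exact: root_in_lattice bP.
Qed.

End TypeC.

(** * Type C *)

Lemma ord_pred_exists r (i : 'I_r) : (0 < i)%N -> exists i' : 'I_r, i'.+1 = i.
Proof.
move=> i0; exists (Ordinal (leq_ltn_trans (leq_pred i) (ltn_ord i))).
exact: prednK.
Qed.

Lemma sign_cancel (s t : int) : s = 1 \/ s = -1 -> s * t = 1 -> t = s.
Proof. by case=> ->; lia. Qed.

Section TypeCSigns.
Variables (R : realType) (E : vectType R) (dot : {dot E for idfun}).
Variable Phi : {fset E}.
Hypothesis hPhi : is_root_system dot Phi.
Variables (r : nat) (Delta : r.-tuple E).
Hypothesis hDelta : is_simple_system Phi Delta.
Notation D i := (tnth Delta i).
Notation A := (cartan_matrix dot Delta).
Notation cf := (root_coef Delta).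
Notation pos := (is_pos_root Phi Delta).
Notation psum := (psum Delta).
Notation psum_prev := (psum_prev Delta).
Notation ecoord := (ecoord Delta).
Hypothesis hA : A = cartan_C r.

(** The part of the sum of the absolute values of the coordinates that comes from
positions other than [p], [q] and [s].  It is common to all vectors that differ
only at these positions, which reduces questions about which combinations are
roots to linear arithmetic in three coordinates. *)
Definition erest (b : E) (p q s : nat) : int :=
  \sum_(k < r | [&& k != p :> nat, k != q :> nat & k != s :> nat])
    `|ecoord b k|.

Lemma ell1_split b p q s : b \in Phi -> (p < r)%N -> (q < r)%N -> (s < r)%N ->
  p != q -> p != s -> q != s ->
  `|ecoord b p| + `|ecoord b q| + `|ecoord b s| + erest b p q s = 2.
Proof.
move=> bP pr qr sr pq ps qs; rewrite -(root_ell1 hPhi hDelta hA bP).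
by rewrite /ell1 (sum_split3 (fun k => `|ecoord b k|) pr qr sr pq ps qs).
Qed.

Lemma erest_ge0 b p q s : 0 <= erest b p q s.
Proof. by apply: sumr_ge0 => k _; exact: normr_ge0. Qed.

Lemma eq_erest a b p q s :
  (forall k, (k < r)%N -> k != p -> k != q -> k != s -> ecoord a k = ecoord b k) ->
  erest a p q s = erest b p q s.
Proof.
by move=> h; apply: eq_bigr => k /and3P[kp kq ks]; rewrite h.
Qed.

Lemma erest_eq0 b p q s k : erest b p q s = 0 -> (k < r)%N ->
  k != p -> k != q -> k != s -> ecoord b k = 0.
Proof.
move=> /eqP; rewrite /erest psumr_eq0 => [/allP h kr kp kq ks|i _]; last exact: normr_ge0.
have := h (Ordinal kr) (mem_index_enum _); rewrite kp kq ks normr_eq0.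
by move/eqP.
Qed.

(** The vector e_a - e_b, for [a <= b < r]. *)
Definition ediff (a b : nat) : E := \sum_(a <= i < b) Delta`_i.

Lemma ediff1 (i : 'I_r) : ediff i i.+1 = D i.
Proof. by rewrite /ediff big_nat1 (tnth_nth 0). Qed.

Lemma ediffS a (i : 'I_r) : (a <= i)%N -> ediff a i.+1 = D i + ediff a i.
Proof. by move=> ai; rewrite /ediff big_nat_recr //= addrC (tnth_nth 0). Qed.

Lemma ediff_root a b : (a < b)%N -> (b < r)%N ->
  pos (ediff a b) /\
  forall k, ecoord (ediff a b) k = (k == a)%:R - (k == b)%:R.
Proof.
elim: b => // b IH; rewrite ltnS => ab br.
pose i := Ordinal (ltnW br); have ir : i.+1 != r by rewrite /=; lia.
have [Eab|nab] := eqVneq a b.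
  rewrite Eab -[b]/(i : nat) ediff1; split; first exact: pos_simple hDelta _.
  by move=> k; rewrite (ecoord_simple hDelta).
have [pe he] : pos (ediff a b) /\
    forall k, ecoord (ediff a b) k = (k == a)%:R - (k == b)%:R.
  by apply: IH; lia.
have eP := pos_root pe; have eL := pos_lattice hDelta pe.
have iL := in_lattice_simple hDelta i.
rewrite -[b]/(i : nat) ediffS //; split; last first.
  move=> k; rewrite ecoordD // (ecoord_simple hDelta) // he /=; ring.
apply: posD => //; first exact: pos_simple hDelta _.
have := refl_root hPhi (simple_root hDelta i) eP.
rewrite (reflE hPhi hDelta) // (cartan_row_inner hA) // !he /=.
have -> : (b == a) = false by lia.
have -> : (b.+1 == a) = false by lia.
have -> : (b.+1 == b) = false by lia.
by rewrite eqxx /= addrC scaleN1r opprK.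
Qed.

(** The long root 2 e_i is obtained from the last simple root by successive
reflections. *)
Lemma double_root (i : 'I_r) : exists2 g, g \in Phi &
  forall k, (k < r)%N -> ecoord g k = 2 * (k == i)%:R.
Proof.
move: i; apply: ord_down_ind => [i ir|i j ij [g gP hg]].
  exists (D i); first exact: simple_root hDelta _.
  by move=> k kr; rewrite (ecoord_simple_last hDelta).
have jr := ltn_ord j; have ir : i.+1 != r by lia.
exists (refl dot (D i) g); first exact: (refl_root hPhi (simple_root hDelta i) gP).
move=> k kr; rewrite (ecoord_refl_inner hPhi hDelta hA) // !hg; try lia.
rewrite -ij eqxx; have -> : (i == i.+1 :> nat) = false by lia.
by have [//|ki] := eqVneq k i; have [//|] := eqVneq k i.+1.
Qed.

Lemma psum_ge0 b k : pos b -> 0 <= psum b k.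
Proof.
move=> pb; apply: sumr_ge0 => i _; rewrite mulr_ge0 ?ler0n // mulr_ge0 //.
  by rewrite /weight_C; case: ifP.
exact: pos_cf pb.
Qed.

Lemma psum_prev_ge0 b k : pos b -> 0 <= psum_prev b k.
Proof. by case: k => [|k] //; exact: psum_ge0. Qed.

Variables (eps : E -> E -> int) (c : 'I_r -> int).
Hypothesis heps : structure_signs Phi Delta eps c.
Hypothesis hc : forall i, c i = 1 \/ c i = -1.

Lemma sign_alt (i j : 'I_r) : i.+1 = j -> c j = - c i.
Proof.
move=> ij; rewrite (simple_sign_alt hPhi hDelta heps (i := i) (j := j)) ?opprK //.
  by rewrite -val_eqE /=; lia.
rewrite hA !mxE -ij eqxx; have -> : (i.+1 == i :> nat) = false by lia.
have -> : (i.+2 == i :> nat) = false by lia.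
by case: ifP.
Qed.

(** Induction on [i].  Let [a < i] and write [e_a - e_(i+1)] as the sum of
[D i = e_i - e_(i+1)] and [y = e_a - e_i].  If [b] has no positive coordinate on
e_i, then [y + b] is not a root, and the Jacobi identity moves [D i] over to [b]:
the sign is - eps(y, D i + b) = - c_(i-1) = c_i.  Otherwise
[b = e_i + e_(i+1)]; now [D i + (e_a - e_(i+1))] is not a root, and writing
[b = D i + 2 e_(i+1)] reduces to the pair formed with 2 e_(i+1), which falls
under the previous case. *)
Lemma signs_ediff (i : 'I_r) a b : (a <= i)%N -> (i.+1 < r)%N -> pos b ->
  1 <= ecoord b i.+1 -> ediff a i.+1 + b \in Phi ->
  eps (ediff a i.+1) b = c i.
Proof.
have [n] := ubnP (i : nat); elim: n i b => // n IH i b hn ai ir pb bi abP.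
have [Eai|nai] := eqVneq a i.
  by move: abP; rewrite Eai ediff1 => abP; apply: (signs_simple heps).
have {nai} ai' : (a < i)%N by rewrite ltn_neqAle nai.
have [i' Ei] := ord_pred_exists (leq_ltn_trans (leq0n a) ai').
have i0r := ltn_ord i; have ar : (a < r)%N := ltn_trans ai' i0r.
have n1 : a != i by rewrite ltn_eqF.
have n2 : a != i.+1 by rewrite ltn_eqF // ltnW.
have n3 : (i : nat) != i.+1 by rewrite ltn_eqF.
have dai : ((a == i) = false) * ((a == i.+1) = false) * ((i == a :> nat) = false)
    * ((i == i.+1 :> nat) = false) * ((i.+1 == a) = false)
    * ((i.+1 == i :> nat) = false).
  by do !split; apply/negbTE; rewrite // eq_sym.
have ci2 : c i * c i = 1 by case: (hc i) => ->.
have pi := pos_simple hDelta i; have iP := pos_root pi.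
have iL := pos_lattice hDelta pi.
have xi k : ecoord (D i) k = (k == i)%:R - (k == i.+1)%:R.
  by apply: (ecoord_simple hDelta); rewrite ltn_eqF.
have [py hy] := ediff_root ai' i0r.
have [pa ha] := ediff_root (leqW ai') ir.
set y := ediff a i in py hy.
have Ea : ediff a i.+1 = D i + y by exact: ediffS.
have yP := pos_root py; have yL := pos_lattice hDelta py.
have aP := pos_root pa; have aL := pos_lattice hDelta pa.
have split3 b' v : v \in Phi -> (forall k, (k < r)%N -> k != a -> k != i ->
    k != i.+1 -> ecoord v k = ecoord b' k) ->
    `|ecoord v a| + `|ecoord v i| + `|ecoord v i.+1| + erest b' a i i.+1 = 2.
  move=> vP hv; rewrite -(eq_erest hv).
  exact: (ell1_split vP ar i0r ir n1 n2 n3).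
(* the case where [b] has no positive coordinate on e_i *)
have caseA b' : pos b' -> 1 <= ecoord b' i.+1 -> ecoord b' i <= 0 ->
    ediff a i.+1 + b' \in Phi -> eps (ediff a i.+1) b' = c i.
  move=> {b pb bi abP} {}pb bi bi0 abP; set b := b' in pb bi bi0 abP *.
  have bP := pos_root pb; have bL := pos_lattice hDelta pb.
  have S0 := split3 b b bP (fun _ _ _ _ _ => erefl).
  have R0 := erest_ge0 b a i i.+1.
  have S1 : `|ecoord b a + 1| + `|ecoord b i| + `|ecoord b i.+1 - 1| +
      erest b a i i.+1 = 2.
    rewrite -(split3 b _ abP) => [|k kr k1 k2 k3].
      by rewrite !ecoordD // !ha !eqxx !dai /= ?subr0 ?sub0r ?addr0 ?add0r ![_ + ecoord b _]addrC.
    by rewrite ecoordD // ha (negPf k1) (negPf k3) subrr add0r.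
  have sgn1 : eps (D i) y = c i.
    by apply: (signs_simple heps) => //; rewrite -Ea.
  suff : eps (D i) y * eps (D i + y) b = 1.
    by rewrite -Ea sgn1; exact: sign_cancel (hc i).
  apply: (signs_jacobi heps) => //; rewrite -?Ea //; first by left.
  - move=> ybP; exfalso.
    have S2 : `|ecoord b a + 1| + `|ecoord b i - 1| + `|ecoord b i.+1| +
        erest b a i i.+1 = 2.
      rewrite -(split3 b _ ybP) => [|k kr k1 k2 k3].
        by rewrite !ecoordD // !hy !eqxx !dai /= ?subr0 ?sub0r ?addr0 ?add0r ![_ + ecoord b _]addrC.
      by rewrite ecoordD // hy (negPf k1) (negPf k2) subrr add0r.
    clear - S0 S1 S2 R0 bi bi0; lia.
  - move=> ibP.
    have S2 : `|ecoord b a| + `|ecoord b i + 1| + `|ecoord b i.+1 - 1| +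
        erest b a i i.+1 = 2.
      rewrite -(split3 b _ ibP) => [|k kr k1 k2 k3].
        by rewrite !ecoordD // !xi !eqxx !dai /= ?subr0 ?sub0r ?addr0 ?add0r ![_ + ecoord b _]addrC.
      by rewrite ecoordD // xi (negPf k2) (negPf k3) subrr add0r.
    have sib : eps (D i) b = c i by apply: (signs_simple heps).
    have : eps y (D i + b) = c i'.
      rewrite /y -Ei; apply: IH.
      + by rewrite Ei.
      + by rewrite -ltnS Ei.
      + by rewrite Ei.
      + exact: posD.
      + by rewrite Ei ecoordD // xi eqxx !dai /=; clear - S0 S2 R0 bi bi0; lia.
      + by rewrite Ei addrCA addrA -Ea.
    by rewrite sib => ->; rewrite (sign_alt Ei); case: (hc i') => ->.
(* the remaining case is [b = e_i + e_(i+1)]; below, [g = 2 e_(i+1)] *)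
have [bi0|bi1] := lerP (ecoord b i) 0; first exact: caseA.
have bP := pos_root pb; have bL := pos_lattice hDelta pb.
have [g gP hg] := double_root (Ordinal ir).
have gL := root_in_lattice hDelta gP.
have S0 := split3 b b bP (fun _ _ _ _ _ => erefl).
have R0 := erest_ge0 b a i i.+1.
have [b_a b_i b_i1 R00] : [/\ ecoord b a = 0, ecoord b i = 1, ecoord b i.+1 = 1
    & erest b a i i.+1 = 0].
  by clear - S0 R0 bi bi1; split; lia.
have Eb : b = D i + g.
  apply: (ecoord_inj hDelta) => //; first exact: in_latticeD.
  move=> k kr; rewrite ecoordD // xi hg //.
  have [->|k1] := eqVneq k a; first by rewrite b_a !dai.
  have [->|k2] := eqVneq k i; first by rewrite b_i !dai.
  have [->|k3] := eqVneq k i.+1; first by rewrite b_i1.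
  by rewrite (erest_eq0 R00).
have pg : pos g.
  apply: (pos_of_cf hPhi hDelta (i := Ordinal ir)) => //.
  have := psum_ge0 i pb; have := psumE Delta g (Ordinal ir).
  have : psum b i.+1 = psum b i + 1.
    by move: b_i1; rewrite /ecoord /= => <-; rewrite addrC subrK.
  rewrite {1}Eb psumD // (psum_simple hDelta) eq_sym !dai mul0r add0r /= => ->.
  by rewrite /weight_C; clear; case: ifP => _; lia.
have bE : D i + g \in Phi by rewrite -Eb; exact: pos_root pb.
have baP : D i + g + ediff a i.+1 \in Phi by rewrite -Eb addrC.
suff : eps (D i) g * eps (D i + g) (ediff a i.+1) = -1.
  rewrite (signs_simple heps) // -Eb (signs_skew heps) //; last by rewrite addrC.
  by rewrite mulrN => /oppr_inj; exact: sign_cancel (hc i).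
apply: (signs_jacobi heps) => //; first by right.
- move=> gyP; have ygP : ediff a i.+1 + g \in Phi by rewrite addrC.
  have i_gyP : D i + (g + ediff a i.+1) \in Phi by rewrite addrA.
  rewrite (signs_skew heps) // caseA //; first last.
  + by rewrite hg // !dai.
  + by rewrite hg // eqxx.
  rewrite (signs_simple heps) ?mulNr ?ci2 //; exact: posD.
- move=> iaP; exfalso; have := erest_ge0 (D i + ediff a i.+1) a i i.+1.
  have := ell1_split iaP ar i0r ir n1 n2 n3.
  rewrite !ecoordD // !xi !ha !eqxx !dai /= => S1 R1.
  by clear -S1 R1; lia.
Qed.

(** The partial sums of the coordinates of a positive root are nonnegative, so a
positive coordinate precedes the negative one; together they exhaust the
absolute sum 2. *)
Lemma pos_ecoord_neg a k : pos a -> (k < r)%N -> ecoord a k <= -1 ->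
  exists2 j, (j < k)%N & a = ediff j k.
Proof.
move=> pa kr ak; have aP := pos_root pa; have aL := pos_lattice hDelta pa.
have [j aj] : exists j : 'I_k, 1 <= ecoord a j.
  apply/existsP; have := psum_ge0 k pa; apply: contraTT => /existsPn h.
  rewrite psum_sum big_ord_recr /= -ltNge.
  set S := \sum_(_ < _) _; have : S <= 0.
    by apply: sumr_le0 => j _ /=; have := h j; clear; lia.
  by move: S ak; clear; lia.
exists j => //; have jk := ltn_ord j; have jr := ltn_trans jk kr.
have [pe he] := ediff_root jk kr; have njk : (j : nat) != k by lia.
apply: (ecoord_inj hDelta) => // [|l lr]; first exact: (pos_lattice hDelta pe).
have := root_ell1 hPhi hDelta hA aP.
rewrite /ell1 (sum_split2 (fun l => `|ecoord a l|) jr kr) // he.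
set rest := \sum_(_ < r | _) _ => S0.
have R0 : 0 <= rest by apply: sumr_ge0 => m _; exact: normr_ge0.
have [a_j a_k R00] : [/\ ecoord a j = 1, ecoord a k = -1 & rest = 0].
  by clear -S0 R0 aj ak; split; lia.
have [->|lj] := eqVneq l j; first by rewrite a_j (negPf njk) subr0.
have [->|lk] := eqVneq l k; first by rewrite a_k sub0r.
rewrite subrr; move/eqP: R00; rewrite psumr_eq0 => [/allP h|m _]; last exact: normr_ge0.
have := h (Ordinal lr) (mem_index_enum _).
by rewrite /= lj lk normr_eq0 => /eqP.
Qed.

(** Without cancellation the absolute values of the coordinates of [a + b] would
sum to 4. *)
Lemma root_sum_cancel a b : a \in Phi -> b \in Phi -> a + b \in Phi ->
  exists2 k, (k < r)%N &
    (ecoord a k <= -1 /\ 1 <= ecoord b k) \/ (ecoord b k <= -1 /\ 1 <= ecoord a k).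
Proof.
move=> aP bP abP; have aL := root_in_lattice hDelta aP.
have bL := root_in_lattice hDelta bP.
have [k hk] : exists k : 'I_r,
    ((ecoord a k <= -1) && (1 <= ecoord b k)) ||
    ((ecoord b k <= -1) && (1 <= ecoord a k)).
  apply/existsP; apply: contraPT (root_ell1 hPhi hDelta hA abP) => /existsPn h.
  have -> : ell1 Delta (a + b) = ell1 Delta a + ell1 Delta b.
    rewrite /ell1 -big_split; apply: eq_bigr => k _ /=; rewrite ecoordD //.
    by have := h k; lia.
  by rewrite !(root_ell1 hPhi hDelta hA).
by exists k => //; case/orP: hk => /andP[]; [left | right].
Qed.

Lemma signs_type_C a b : pos a -> pos b -> a + b \in Phi ->
  exists (i : 'I_r) j, [/\ (j <= i)%N, (i.+1 < r)%N &
    [/\ a = ediff j i.+1, 1 <= ecoord b i.+1 & eps a b = c i] \/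
    [/\ b = ediff j i.+1, 1 <= ecoord a i.+1 & eps a b = - c i]].
Proof.
move=> pa pb abP; have baP : b + a \in Phi by rewrite addrC.
have key a' b' k : pos a' -> pos b' -> a' + b' \in Phi -> (k < r)%N ->
    ecoord a' k <= -1 -> 1 <= ecoord b' k ->
    exists (i : 'I_r) j, [/\ (j <= i)%N, (i.+1 < r)%N &
    [/\ a' = ediff j i.+1, 1 <= ecoord b' i.+1 & eps a' b' = c i]].
  move=> pa' pb' abP' kr ak bk; have [j jk Ea] := pos_ecoord_neg pa' kr ak.
  case: k => // k in kr ak bk jk Ea.
  exists (Ordinal (ltnW kr)), j; split=> //=; split=> //.
  by rewrite Ea; apply: (signs_ediff (i := Ordinal (ltnW kr))); rewrite -?Ea.
have [k kr [[ak bk]|[bk ak]]] := root_sum_cancel (pos_root pa) (pos_root pb) abP.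
  by have [i [j [ji ir h]]] := key a b k pa pb abP kr ak bk; exists i, j; split=> //; left.
have [i [j [ji ir [Eb h1 h2]]]] := key b a k pb pa baP kr bk ak.
by exists i, j; split=> //; right; split=> //; rewrite (signs_skew heps) // h2.
Qed.

(** ** The form rho *)

Hypothesis hr : (2 <= r)%N.
Notation rho := (rho_vec dot Phi Delta c).

Definition rho_skew (a b : E) : int := rho a b - rho b a.

Let norm_data := norm_C hPhi hDelta hr hA.

Lemma weight_C12 (i : 'I_r) : weight_C i = 1 \/ weight_C i = 2.
Proof. by rewrite /weight_C; case: ifP; [right | left]. Qed.

Lemma weight_C_first : weight_C (Ordinal (ltnW hr)) = 1.
Proof. by rewrite /weight_C /=; case: eqP => // E1; move: hr; rewrite -E1. Qed.

Lemma rho_skewDl a b x : in_lattice Delta a -> in_lattice Delta b ->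
  rho_skew (a + b) x = rho_skew a x + rho_skew b x.
Proof.
have [s s0 hs] := norm_data; move=> aL bL; rewrite /rho_skew.
rewrite (rhoDl hPhi hDelta c s0 weight_C12 weight_C_first hs) //.
by rewrite (rhoDr hPhi hDelta c s0 weight_C12 weight_C_first hs) //; ring.
Qed.

Lemma rho_skew_simple (i : 'I_r) b : (i.+1 < r)%N ->
  rho_skew (D i) b = c i * (psum_prev b i + psum b i.+1).
Proof.
have [s s0 hs] := norm_data; move=> ir; have ir' : i.+1 != r by lia.
rewrite /rho_skew (rho_sub hPhi hDelta heps hc s0 weight_C12 weight_C_first hs).
rewrite (bigD1 i) //= [X in _ + X]big1 ?addr0; last first.
  move=> k ki; rewrite big1 // => j _.
  by rewrite (cf_simple hDelta) (negPf ki) mulr0 mul0r.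
have := cartan_row_inner hA b ir'; rewrite (bigD1 i) //= /ecoord /=.
rewrite psumE /weight_C (negPf ir') mul1r hA !mxE eqxx => Erow.
rewrite (bigD1 i) //= eqxx !mul0r add0r (cf_simple hDelta) eqxx.
have -> : \sum_(j < r | j != i)
    (if i != j then c i * gram dot Delta (@weight_C r) i j else 0) * true%:R *
    cf b j = c i * \sum_(j < r | j != i) cartan_C r i j * cf b j.
  rewrite mulr_sumr; apply: eq_bigr => j ji.
  by rewrite eq_sym ji /gram /weight_C (negPf ir') mul1r hA /=; ring.
rewrite -mulrN; congr (_ * _); move: Erow; set S := \sum_(_ < _ | _) _.
by move: S; clear; lia.
Qed.

Lemma ecoord_ge0_before b n k : pos b -> (n < r)%N -> 1 <= ecoord b n ->
  (k < n)%N -> 0 <= ecoord b k.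
Proof.
move=> pb nr bn kn; have kr := ltn_trans kn nr; rewrite leNgt; apply/negP => bk.
have [|j jk Eb] := pos_ecoord_neg pb kr; first by lia.
have [_ he] := ediff_root jk kr; move: bn; rewrite Eb he.
have -> : (n == j) = false by lia.
by have -> : (n == k) = false by lia.
Qed.

(** Raising [i] by one replaces [W], the difference between
[c i * rho_skew (ediff a i.+1) b] and [ecoord b i.+1], by [2 * psum b i - W],
since [c] changes sign; this keeps both bounds. *)
Lemma rho_skew_bounds (i : 'I_r) a b : pos b -> (a <= i)%N -> (i.+1 < r)%N ->
  (forall k, (k <= i)%N -> 0 <= ecoord b k) ->
  0 <= c i * rho_skew (ediff a i.+1) b - ecoord b i.+1 <= 2 * psum b i.
Proof.
move=> pb; have [n] := ubnP (i : nat); elim: n i => // n IH i hn ai ir hpos.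
have ci2 : c i * c i = 1 by case: (hc i) => ->.
have bi := hpos i (leqnn i).
have [Eai|nai] := eqVneq a i.
  rewrite Eai ediff1 rho_skew_simple // mulrA ci2 mul1r.
  by have := psum_prev_ge0 i pb; move: bi; rewrite /ecoord /=; clear; lia.
have {nai} ai' : (a < i)%N by rewrite ltn_neqAle nai.
have [i' Ei] := ord_pred_exists (leq_ltn_trans (leq0n a) ai').
have [pe _] := ediff_root ai' (ltn_ord i).
have iL := in_lattice_simple hDelta i; have eL := pos_lattice hDelta pe.
rewrite ediffS // rho_skewDl // rho_skew_simple //.
have IH' : 0 <= c i' * rho_skew (ediff a i) b - ecoord b i <= 2 * psum b i'.
  rewrite -Ei; apply: IH; rewrite ?Ei //; first by rewrite -ltnS Ei.
  by move=> k ki; apply: hpos; rewrite -Ei leqW.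
have Epr : psum_prev b i = psum b i' by rewrite -Ei.
have bi' : ecoord b i = psum b i - psum b i' by rewrite /ecoord Epr.
have step X Y : c i * (c i * X + Y) = X - c i' * Y.
  by rewrite mulrDr mulrA ci2 mul1r (sign_alt Ei) mulNr.
rewrite step Epr; move: IH'.
have -> : ecoord b i.+1 = psum b i.+1 - psum b i by [].
by move: bi bi'; clear; move: (c i' * _) => S; lia.
Qed.

Lemma psum_le2 b k : b \in Phi -> (k < r)%N -> psum b k <= 2.
Proof.
move=> bP kr; rewrite -(root_ell1 hPhi hDelta hA bP) psum_sum /ell1.
rewrite (big_ord_widen _ (ecoord b) kr) big_mkcond /=.
by apply: ler_sum => i _; case: ifP => _; rewrite ?normr_ge0 ?ler_norm.
Qed.

(** By [rho_skew_bounds] the value lies between [x] and [x + 2 * p], where [x] is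
the coordinate of [b] on e_(i+1) and [p] the sum of the earlier ones; and
[1 <= x], while [x + p <= 2] because the absolute sum is 2. *)
Lemma rho_skew_ediff (i : 'I_r) a b : (a <= i)%N -> (i.+1 < r)%N -> pos b ->
  1 <= ecoord b i.+1 -> 1 <= c i * rho_skew (ediff a i.+1) b <= 3.
Proof.
move=> ai ir pb bi.
have /(rho_skew_bounds pb ai ir) : forall k, (k <= i)%N -> 0 <= ecoord b k.
  by move=> k ki; exact: (ecoord_ge0_before pb ir bi).
have := psum_le2 (pos_root pb) ir; have := psum_ge0 i pb.
by move: bi; rewrite /ecoord /=; clear; lia.
Qed.

Corollary rho_type_C a b : pos a -> pos b -> a + b \in Phi ->
  rho a b - rho b a \in [:: 1; -1; 2; -2; 3; -3] /\
  (rho b a < rho a b -> eps a b = 1) /\ (rho a b < rho b a -> eps a b = -1).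
Proof.
move=> pa pb abP; have [i [j [ji ir h]]] := signs_type_C pa pb abP.
case: h => -[Ea bi ->]; [have := rho_skew_ediff ji ir pb bi
                        | have := rho_skew_ediff ji ir pa bi];
  rewrite -Ea /rho_skew !inE; case: (hc i) => ->; clear; lia.
Qed.

End TypeCSigns.

(** * Renumbering the simple roots *)

Section Reindex.
Variables (R : realType) (E : vectType R) (dot : {dot E for idfun}).
Variable Phi : {fset E}.
Variables (r : nat) (Delta : r.-tuple E).
Hypothesis hDelta : is_simple_system Phi Delta.
Variable s : 'S_r.

(** The hypothesis on the type fixes the Cartan matrix up to a permutation of the
nodes; renumbering the simple roots turns it into the standard matrix without
changing positive roots, signs or rho. *)
Definition reindexed : r.-tuple E := [tuple tnth Delta (s i) | i < r].

Lemma reindexed_simple_system : is_simple_system Phi reindexed.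
Proof.
have [hsub hbasis hsign] := hDelta.
have hperm : perm_eq reindexed Delta by apply/tuple_permP; exists s.
split=> [a||b bP].
- by rewrite (perm_mem hperm); exact: hsub.
- by rewrite (perm_basis _ hperm).
have [n hn] := hsign b bP; exists (fun i => n (s i)) => /=.
have -> : \sum_i tnth reindexed i *+ n (s i) = \sum_i tnth Delta i *+ n i.
  rewrite [RHS](reindex_inj (@perm_inj _ s)).
  by apply: eq_bigr => i _; rewrite tnth_mktuple.
exact: hn.
Qed.

Lemma coord_reindexed i b : coord reindexed i b = coord Delta (s i) b.
Proof.
have Eb : b = \sum_j coord Delta (s j) b *: tnth reindexed j.
  rewrite {1}(coord_basis (basisD hDelta) (memvf b)).
  rewrite (reindex_inj (@perm_inj _ s)) /=; apply: eq_bigr => j _.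
  by rewrite tnth_mktuple (tnth_nth 0).
by rewrite {1}Eb (coord_sum_simple reindexed_simple_system).
Qed.

Lemma root_coef_reindexed b i : root_coef reindexed b i = root_coef Delta b (s i).
Proof. by rewrite /root_coef coord_reindexed. Qed.

Lemma is_pos_root_reindexed b :
  is_pos_root Phi reindexed b = is_pos_root Phi Delta b.
Proof.
rewrite /is_pos_root; congr (_ && _); apply/forallP/forallP => h i.
  by have := h ((s^-1)%g i); rewrite coord_reindexed permKV.
by rewrite coord_reindexed.
Qed.

Lemma cartan_matrix_reindexed i j :
  cartan_matrix dot reindexed i j = cartan_matrix dot Delta (s i) (s j).
Proof. by rewrite !mxE !tnth_mktuple. Qed.

Lemma rho_vec_reindexed c a b :
  rho_vec dot Phi reindexed (fun i => c (s i)) a b = rho_vec dot Phi Delta c a b.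
Proof.
rewrite /rho_vec [RHS](reindex_inj (@perm_inj _ s)); apply: eq_bigr => i _.
rewrite [RHS](reindex_inj (@perm_inj _ s)) /=.
apply: eq_big => [j|j _]; rewrite cartan_matrix_reindexed.
  by rewrite (inj_eq perm_inj).
by rewrite !root_coef_reindexed /root_weight tnth_mktuple.
Qed.

Lemma structure_signs_reindexed eps c : structure_signs Phi Delta eps c ->
  structure_signs Phi reindexed eps (fun i => c (s i)).
Proof.
case=> h1 h2 h3 h4; split=> [a b|a b|i b|t x y z]; rewrite !is_pos_root_reindexed.
- exact: h1.
- exact: h2.
- by rewrite tnth_mktuple; exact: h3.
- exact: h4.
Qed.

End Reindex.

(** * The sign formulas *)

Theorem proposition4p6
  (R : realType)
  (E : vectType R) (dot : {dot E for idfun}) (Phi : {fset E})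
  (hPhi : is_root_system dot Phi) (irrPhi : is_irreducible dot Phi)
  (r : nat) (hr : (2 <= r)%N)
  (Delta : r.-tuple E) (hDelta : is_simple_system Phi Delta)
  (L : lieAlgType R[i]) (hL : simple_lie L)
  (H : {vspace L}) (hH : is_cartan_subalgebra H)
  (iota : E -> 'Hom(subvs_of H, R[i]^o))
  (hiota : is_root_identification Phi iota)
  (e : E -> L) (eps : E -> E -> int) (c : 'I_r -> int)
  (he : is_special_chevalley_system Phi iota e eps Delta c) :
  let A := cartan_matrix dot Delta in
  let rho := rho_vec dot Phi Delta c in
  (same_type A (cartan_B r) \/ same_type A (cartan_C r)) ->
  forall alpha beta : E,
    is_pos_root Phi Delta alpha -> is_pos_root Phi Delta beta ->
    alpha + beta \in Phi ->
    (same_type A (cartan_B r) ->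
       (2 %| rho alpha beta)%Z /\
       eps alpha beta = (-1) ^ (rho alpha beta %/ 2)%Z) /\
    (same_type A (cartan_C r) ->
       rho alpha beta - rho beta alpha \in [:: 1; -1; 2; -2; 3; -3] /\
       (rho beta alpha < rho alpha beta -> eps alpha beta = 1) /\
       (rho alpha beta < rho beta alpha -> eps alpha beta = -1)).
Proof.
move=> A rho _ alpha beta pa pb abP.
have heps := special_structure_signs hPhi hDelta hiota he.
have hc i : c i = 1 \/ c i = -1 by have [_ /(_ i)[]] := he.
have cartanE (A' : 'M[int]_r) (s : 'S_r) :
    (forall i j, A (s i) (s j) = A' i j) ->
    cartan_matrix dot (reindexed Delta s) = A'.
  by move=> hs; apply/matrixP => i j; rewrite cartan_matrix_reindexed hs.
split=> -[s /cartanE hA]; rewrite /rho -!(rho_vec_reindexed dot hDelta s c).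
- apply: (rho_type_B hPhi (reindexed_simple_system hDelta s) hr
    (structure_signs_reindexed hDelta s heps)) => //.
  + by rewrite is_pos_root_reindexed.
  + by rewrite is_pos_root_reindexed.
- apply: (rho_type_C hPhi (reindexed_simple_system hDelta s) hA
    (structure_signs_reindexed hDelta s heps) _ hr) => //.
  + by rewrite is_pos_root_reindexed.
  + by rewrite is_pos_root_reindexed.
Qed.
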